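(* Let $\dim V=2n\ge 4$ and fix $J\in\mathcal{T}(V,g)$. Let $$\psi:E^{S}\to T\mathcal{T},\qquad \psi(A)=[FAF,\phi],$$ where a) $F=QS\in\Gamma(\mathfrak{gl}(\mathbb{V}))$ with $Q=a_{k}\{J,\phi\}^{k}+\dots+a_{1}\{J,\phi\}+a_{0}\mathbb{1}$, $a_{i}\in C^{\infty}(\mathcal{T})$, and $S\in\{\mathbb{1},\,J+\phi,\,J-\phi,\,[J,\phi]\}$; b) $E=\mathfrak{u}(\mathbb{V},J)$. Moreover, suppose $a_{i}\in\mathbb{R}[f_{1},\dots,f_{2n}]$ for every $i$, where the $f_{j}\in C^{\infty}(\mathcal{T})$ are defined via $$\det(\lambda\mathbb{1}-\{J,\phi\})=\lambda^{2n}-f_{1}\lambda^{2n-1}+\dots-f_{2n-1}\lambda+f_{2n}.$$ Then there exists a skew bracket $[\cdot,\cdot]_{F}$ on $\Gamma(E^{S})$ such that $(E^{S},[\cdot,\cdot]_{F},\psi)$ is a skew algebroid on $\mathcal{T}(V,g)$.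
   Context: $(V,g)$ is a $2n$-dimensional real vector space with a positive definite metric. $\mathcal{T}=\mathcal{T}(V,g)=\{K\in \mathrm{End}V : K^{2}=-1,\ g(K\cdot,K\cdot)=g(\cdot,\cdot)\}$, a submanifold of $\mathrm{End}V$, with $T_K\mathcal{T}=\{A\in\mathfrak{o}(V,g): AK+KA=0\}$. $\mathbb{V}=V\times\mathcal{T}$, $\mathfrak{gl}(\mathbb{V})=\mathrm{End}V\times\mathcal{T}$, $\mathfrak{o}(\mathbb{V},g)=\mathfrak{o}(V,g)\times\mathcal{T}$. $\phi$ is the section with $\phi|_K=K$; $J$ and $\mathbb{1}$ are regarded as constant sections. $[A,B]=AB-BA$, $\{A,B\}=AB+BA$. $\mathfrak{u}(\mathbb{V},J)=\{A\in\mathfrak{o}(\mathbb{V},g):[A,J]=0\}$. Definition of $E^{S}$: for $S\in\{\mathbb{1},J+\phi,J-\phi,[J,\phi]\}$ and $\gamma\in\{\pm J,\pm\phi\}$ there is a unique $\tilde\gamma\in\{\pm J,\pm\phi\}$ with $\gamma S=S\tilde\gamma$, and it is also the unique element of $\{\pm J,\pm\phi\}$ with $S\gamma=\tilde\gamma S$. If $E=\{A\in\mathfrak{o}(\mathbb{V},g):\gamma A=A\delta\}$ with $\gamma\in\{\pm J,\pm\phi\}$ and $\delta\in\{+\gamma,-\gamma\}$ (for $E=\mathfrak{u}(\mathbb{V},J)$, $\gamma=\delta=J$), then $E^{S}=\{B\in\mathfrak{o}(\mathbb{V},g):\tilde\gamma B=B\tilde\delta\}$, where $\gamma S=S\tilde\gamma$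 and $S\delta=\tilde\delta S$. A skew algebroid $(E,[\cdot,\cdot],\psi)$ on $\mathcal{T}$ is a vector bundle with a skew bracket on $\Gamma(E)$ and a bundle map $\psi:E\to T\mathcal{T}$ such that $\psi([A,B])=[\psi(A),\psi(B)]_{Lie}$ and $[A,fB]=f[A,B]+\psi(A)[f]B$ for all $A,B\in\Gamma(E)$, $f\in C^\infty(\mathcal{T})$. *)

(* Defs.v *)
From HB Require Import structures.
From mathcomp Require Import all_boot all_order all_algebra.
From mathcomp Require Import all_classical all_reals all_analysis.
From mathcomp Require mpoly.

Set Implicit Arguments.
Unset Strict Implicit.
Unset Printing Implicit Defensive.

Import Order.TTheory GRing.Theory Num.Theory.
Import numFieldNormedType.Exports.

Local Open Scope classical_set_scope.
Local Open Scope ring_scope.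

Section Endomorphisms.
Variables (R : realType) (V : vectType R).
Implicit Types A B : 'End(V).

Definition commutator A B : 'End(V) := ((A \o B) - (B \o A))%VF.
Definition anticommutator A B : 'End(V) := ((A \o B) + (B \o A))%VF.
Definition lfun_exp A (k : nat) : 'End(V) := iter k (comp_lfun A) \1%VF.

(* The value does not depend on the chosen basis. *)
Definition lfun_det A : R :=
  \det (passmx.mxof (vbasis {:V}) (vbasis {:V}) A).

Definition endo_coords A : 'rV[R]_(\dim {:'End(V)}) :=
  passmx.rVof (vbasis {:'End(V)}) A.

End Endomorphisms.

Section SmoothFunctions.
Variables (R : realType) (d : nat).

(* For an open set U, [Ck k U F] says that F is of class C^k on U; differentials
   are total functions, and [Ck k U F] only looks at their values in U. *)
Fixpoint Ck (k : nat) (U : set 'rV[R]_d) (F : 'rV[R]_d -> R) : Prop :=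
  if k is k'.+1 then
    (forall x, U x -> differentiable F x) /\
    (forall v, Ck k' U (fun x => 'D_v F x))
  else forall x, U x -> {for x, continuous F}.

Definition smooth_on (U : set 'rV[R]_d) (F : 'rV[R]_d -> R) : Prop :=
  forall k, Ck k U F.

End SmoothFunctions.

Section TwistorSpace.
Variables (R : realType) (V : vectType R) (g : {dot V for idfun}).

Record twistor := Twistor {
  twistor_endo :> 'End(V);
  twistor_sqr : (twistor_endo \o twistor_endo)%VF = - \1%VF;
  twistor_isometry :
    forall u v : V, g (twistor_endo u) (twistor_endo v) = g u v
}.

Definition orthogonal_algebra : set 'End(V) :=
  [set A : 'End(V) | forall u v : V, g (A u) v + g u (A v) = 0].

Definition tangent_space (K : twistor) : set 'End(V) :=
  [set A | orthogonal_algebra A /\ ((A \o K) + (K \o A))%VF = 0].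

(* The smooth structure of the twistor space as a submanifold of End V: a
   function is smooth when it extends locally to a smooth function on an open
   subset of End V. *)
Definition local_extension (f : twistor -> R) (K : twistor) :
    set ('rV[R]_(\dim {:'End(V)}) -> R) :=
  [set F | exists U, [/\ open U, U (endo_coords K), smooth_on U F &
    forall L : twistor, U (endo_coords L) -> f L = F (endo_coords L)]].

Definition smooth_at (f : twistor -> R) (K : twistor) : Prop :=
  exists F, local_extension f K F.

Definition smooth (f : twistor -> R) : Prop := forall K, smooth_at f K.

Definition endo_smooth_at (A : twistor -> 'End(V)) (K : twistor) : Prop :=
  forall i, smooth_at (fun L => endo_coords (A L) 0 i) K.

Definition endo_smooth (A : twistor -> 'End(V)) : Prop :=
  forall K, endo_smooth_at A K.

(* df_K(A), for f smooth and A tangent at K; for such f and A the value does not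
   depend on the extension picked by [get]. *)
Definition differential (f : twistor -> R) (K : twistor) (A : 'End(V)) : R :=
  'D_(endo_coords A) (get (local_extension f K)) (endo_coords K).

(* X[f] for a vector field X and a function f *)
Definition lie_derivative (X : twistor -> 'End(V)) (f : twistor -> R) :
    twistor -> R :=
  fun K => differential f K (X K).

(* Z = [X, Y]_Lie *)
Definition is_lie_bracket (X Y Z : twistor -> 'End(V)) : Prop :=
  forall f, smooth f -> forall K,
    lie_derivative Z f K =
    lie_derivative X (lie_derivative Y f) K -
    lie_derivative Y (lie_derivative X f) K.

Section SkewAlgebroids.
Variable E : twistor -> set 'End(V).

(* E is a vector subbundle of rank r of the trivial bundle End V x T. *)
Definition is_subbundle (r : nat) : Prop :=
  forall K : twistor, exists U (s : 'I_r -> twistor -> 'End(V)),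
    [/\ open U, U (endo_coords K) &
      forall L : twistor, U (endo_coords L) ->
        [/\ forall i, endo_smooth_at (s i) L,
            free [tuple s i L | i < r] &
            forall B, E L B <-> B \in <<[tuple s i L | i < r]>>%VS]].

Definition is_section (A : twistor -> 'End(V)) : Prop :=
  endo_smooth A /\ forall K, E K (A K).

Variable psi : twistor -> 'End(V) -> 'End(V).

Definition on_sections (A : twistor -> 'End(V)) : twistor -> 'End(V) :=
  fun K => psi K (A K).

Definition is_bundle_map_to_tangent : Prop :=
  [/\ forall K A, E K A -> tangent_space K (psi K A),
      forall K c A B, E K A -> E K B ->
        psi K (c *: A + B) = c *: psi K A + psi K B &
      forall A, is_section A -> endo_smooth (on_sections A)].

(* [br] is only meaningful on sections of E. *)
Record skew_algebroid
    (br : (twistor -> 'End(V)) -> (twistor -> 'End(V)) -> twistor -> 'End(V)) :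
    Prop := SkewAlgebroid {
  skew_algebroid_bundle : exists r, is_subbundle r;
  skew_algebroid_anchor : is_bundle_map_to_tangent;
  skew_algebroid_closed : forall A B,
    is_section A -> is_section B -> is_section (br A B);
  skew_algebroid_skew : forall A B,
    is_section A -> is_section B -> forall K, br A B K = - br B A K;
  skew_algebroid_linear : forall (c : R) A B C,
    is_section A -> is_section B -> is_section C ->
    forall K, br A (fun L => c *: B L + C L) K = c *: br A B K + br A C K;
  skew_algebroid_lie : forall A B, is_section A -> is_section B ->
    is_lie_bracket (on_sections A) (on_sections B) (on_sections (br A B));
  skew_algebroid_leibniz : forall A B f,
    is_section A -> is_section B -> smooth f -> forall K,
    br A (fun L => f L *: B L) K =
    f K *: br A B K + lie_derivative (on_sections A) f K *: B K
}.

End SkewAlgebroids.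

Variable J : twistor.

Definition const_section (A : 'End(V)) : twistor -> 'End(V) := fun=> A.
Definition phi : twistor -> 'End(V) := fun K => K.

Definition unit_sections : set (twistor -> 'End(V)) :=
  [set const_section J; const_section (- (J : 'End(V)));
       phi; fun K => - phi K].

Definition S_sections : set (twistor -> 'End(V)) :=
  [set const_section \1%VF; fun K => (J : 'End(V)) + phi K;
       fun K => (J : 'End(V)) - phi K; fun K => commutator J (phi K)].

(* {A in o(V, g) : gamma A = A delta} *)
Definition intertwining_bundle (gamma delta : twistor -> 'End(V)) :
    twistor -> set 'End(V) :=
  fun K => [set A | orthogonal_algebra A /\
                    (gamma K \o A)%VF = (A \o delta K)%VF].

Definition unitary_bundle : twistor -> set 'End(V) :=
  fun K => [set A | orthogonal_algebra A /\ commutator A J = 0].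

Lemma unitary_bundleE :
  unitary_bundle =
  intertwining_bundle (const_section J) (const_section J).
Proof.
apply/funext => K; apply/seteqP; split=> A [oA AJ]; split=> //.
  by move: AJ => /eqP; rewrite subr_eq0 => /eqP.
by rewrite /commutator -AJ subrr.
Qed.

(* E^S for E = [intertwining_bundle gamma delta]: here gamma' and delta' are the
   unique elements of {+-J, +-phi} with gamma S = S gamma' and
   S delta = delta' S. *)
Definition twisted_bundle (gamma delta S : twistor -> 'End(V)) :
    twistor -> set 'End(V) :=
  fun K => [set B | exists gamma' delta',
    [/\ unit_sections gamma' /\ unit_sections delta',
        forall L, (gamma L \o S L)%VF = (S L \o gamma' L)%VF,
        forall L, (S L \o delta L)%VF = (delta' L \o S L)%VF &
        intertwining_bundle gamma' delta' K B]].

(* E^S for E = u(V, J), with the presentation of [unitary_bundleE] *)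
Definition twisted_unitary_bundle (S : twistor -> 'End(V)) :
    twistor -> set 'End(V) :=
  twisted_bundle (const_section J) (const_section J) S.

End TwistorSpace.

Arguments phi {R V g}.

(* Main.v *)
Require Import Defs.
From HB Require Import structures.
From mathcomp Require Import all_boot all_order all_algebra.
From mathcomp Require Import all_classical all_reals all_analysis.
From mathcomp Require Import ring lra zify.
From mathcomp Require mpoly.

Set Implicit Arguments.
Unset Strict Implicit.
Unset Printing Implicit Defensive.

Import Order.TTheory GRing.Theory Num.Theory.
Import numFieldNormedType.Exports.

Local Open Scope classical_set_scope.
Local Open Scope ring_scope.

(** The bracket is explicit. For sections A, B of E^S put C = F A F and
    D = F B F, so that X = psi(A) = [C, phi] and Y = psi(B) = [D, phi], and let d
    be the flat derivative of maps from T to End V. Then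
<<
      [A, B]_F = d_X B - d_Y A - [C, B] + [D, A] + A F^2 B - B F^2 A .
>>
    The fibre of E^S consists of the skew endomorphisms that commute with
    gamma, where gamma = J for S = 1 and S = [J, phi], and gamma = phi for
    S = J + phi and S = J - phi ([twisted_unitaryP]). Since F intertwines J and
    gamma up to a sign, C commutes with J.

    Everything rests on the derivation d_X - [C, .] along X = [C, phi], with C
    skew and commuting with J. It kills J because d_X J = 0 = [C, J], and phi
    because d_X phi = X = [C, phi]; hence it kills {J, phi} and S. It also kills
    the coefficients a_i: the curve R_t K R_t^-1, with R_t the Cayley transform
    of t C, has velocity [C, K] at t = 0, and R_t commutes with J, so {J, .} is
    merely conjugated along it and its characteristic polynomial, hence every
    f_j and every polynomial in the f_j, stays constant ([char_invariant]).
    Therefore d_X F = [C, F] and d_X gamma = [C, gamma].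

    Two consequences prove the theorem. First, d_X B - [C, B] commutes with
    gamma when B does ([covariant_comm]), so the bracket takes values in E^S.
    Second, F [A, B]_F F = d_X D - d_Y C - [C, D], and the Jacobi identity turns
    [F [A, B]_F F, phi] into d_X Y - d_Y X ([X_bracket]), the Lie bracket of the
    vector fields X and Y ([is_lie_bracketP]). Skew symmetry and the Leibniz
    rule are read off the formula.

    Three facts about T support this. The derivative of a function in a tangent
    direction is its derivative along a Cayley curve, so it does not depend on
    the local extension ([differential_extension]). Second derivatives of smooth
    functions are symmetric ([derive_comm]). Finally E^S is a vector bundle: any
    two elements of T are joined by successive conjugations with reflections, so
    the rank is constant ([commuting_skew_dim]), and for L close to K the map
    B |-> (K + L) B (K + L) carries a basis of the fibre at K to one of the fibre
    at L ([commuting_skew_subbundle]). *)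

(** * Functions of class C^k and the symmetry of second derivatives *)

Lemma near_eq_differentiable (R : numFieldType) (V W : normedModType R)
    (F G : V -> W) (x : V) :
  (\near x, F x = G x) -> differentiable F x -> differentiable G x.
Proof.
move=> FG dF.
have cdF : continuous ('d F x) by exact: diff_continuous.
have key : G \o shift x = cst (G x) + 'd F x +o_ 0 id.
  apply/eqaddoP => e e0.
  have /eqaddoP/(_ e e0) := diff_locally dF.
  have : \forall h \near (0 : V), F (h + x) = G (h + x).
    have := FG; rewrite (near_shift 0 x) /=.
    by apply: filterS => h; rewrite /= subr0.
  move=> H1 H2; near=> h.
  have e1 : F (h + x) = G (h + x) by near: h.
  suff : `|(F \o shift x - (cst (F x) + 'd F x)) h| <= e * `|h|.
    by rewrite /= !fctE /= e1 (nbhs_singleton FG).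
  by near: h.
apply/diff_locallyP; split; rewrite (diff_unique cdF key) //.
Unshelve. all: by end_near. Qed.

Section SmoothCalculus.
Variables (R : realType) (d : nat).
Implicit Types (F G : 'rV[R]_d -> R) (U W : set 'rV[R]_d).

Lemma open_near U (x : 'rV[R]_d) (P : 'rV[R]_d -> Prop) : open U -> U x ->
  (forall y, U y -> P y) -> \forall y \near x, P y.
Proof.
move=> oU Ux UP; apply: filterS UP _.
exact: (open_nbhs_nbhs (conj oU Ux)).
Qed.

Lemma Ck_ext k U F G : open U -> (forall x, U x -> F x = G x) ->
  Ck k U F -> Ck k U G.
Proof.
move=> oU; elim: k F G => [|k IH] F G FG /=.
  move=> cF x Ux.
  rewrite /prop_for /continuous_at -(FG _ Ux).
  apply: cvg_trans (cF x Ux).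
  by apply: (@near_eq_cvg _ _ (nbhs x)); exact: (open_near oU Ux FG).
move=> [dF DF].
have nFG x : U x -> \near x, F x = G x.
  by move=> Ux; exact: open_near FG.
split=> [x Ux|v]; first by apply: near_eq_differentiable (dF x Ux); exact: nFG.
by apply: IH (DF v) => x Ux; apply: near_eq_derive; exact: nFG.
Qed.

Lemma Ck_subset k U W F : W `<=` U -> Ck k U F -> Ck k W F.
Proof.
move=> WU; elim: k F => [|k IH] F /=; first by move=> cF x /WU; exact: cF.
by move=> [dF DF]; split=> [x /WU|v]; [exact: dF|exact: IH].
Qed.

Lemma Ck_pred k U F : Ck k.+1 U F -> Ck k U F.
Proof.
elim: k F => [|k IH] F [dF DF] /=.
  by move=> x Ux; apply: differentiable_continuous; exact: dF.
by split=> // v; apply: IH; exact: DF.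
Qed.

Lemma Ck_cst k U (c : R) : Ck k U (cst c).
Proof.
elim: k c => [|k IH] c /=.
  by move=> x _; apply: differentiable_continuous; exact: differentiable_cst.
split=> [x _|v]; first exact: differentiable_cst.
by have -> : (fun x => 'D_v (cst c) x) = cst (0 : R)
  by apply/funext => x; rewrite derive_cst.
Qed.

Lemma Ck_add k U F G : open U -> Ck k U F -> Ck k U G ->
  Ck k U (fun x => F x + G x).
Proof.
move=> oU; elim: k F G => [|k IH] F G /=.
  by move=> cF cG x Ux; apply: continuousD; [exact: cF|exact: cG].
move=> [dF DF] [dG DG]; split=> [x Ux|v].
  by apply: differentiableD; [exact: dF|exact: dG].
apply: (Ck_ext oU) (IH _ _ (DF v) (DG v)) => x Ux.
by rewrite -deriveD //; apply: diff_derivable; [exact: dF|exact: dG].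
Qed.

Lemma Ck_mul k U F G : open U -> Ck k U F -> Ck k U G ->
  Ck k U (fun x => F x * G x).
Proof.
move=> oU; elim: k F G => [|k IH] F G /=.
  by move=> cF cG x Ux; apply: continuousM; [exact: cF|exact: cG].
move=> CF CG; have [dF DF] := CF; have [dG DG] := CG; split=> [x Ux|v].
  by apply: differentiableM; [exact: dF|exact: dG].
have H : Ck k U (fun x => F x * 'D_v G x + G x * 'D_v F x).
  by apply: Ck_add => //; apply: IH => //; exact: Ck_pred.
apply: (Ck_ext oU) H => x Ux.
by rewrite -deriveM //; apply: diff_derivable; [exact: dF|exact: dG].
Qed.

Lemma Ck_coord k U (i : 'I_d) : Ck k U (fun x => x 0 i).
Proof.
case: k => [|k] /=.
  move=> x _; apply: differentiable_continuous; exact: differentiable_coord.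
split=> [x _|v]; first exact: differentiable_coord.
have -> : (fun x : 'rV[R]_d => 'D_v (fun x0 : 'rV[R]_d => x0 0 i) x) = cst (v 0 i).
  apply/funext => x; rewrite deriveE; last exact: differentiable_coord.
  pose p (y : 'rV[R]_d) := y 0 i.
  have lp : linear p by move=> a y z; rewrite /p !mxE.
  pose pl : {linear 'rV[R]_d -> R} :=
    HB.pack p (GRing.isLinear.Build _ _ _ _ _ lp).
  rewrite -[fun _ => _]/(pl : _ -> _) diff_lin //.
  by move=> y; apply: differentiable_continuous; exact: differentiable_coord.
exact: Ck_cst.
Qed.

Lemma is_derive_curve F (c : R -> 'rV[R]_d) (t : R) (v : 'rV[R]_d) :
  differentiable F (c t) -> is_derive t 1 c v ->
  is_derive t 1 (F \o c) ('D_v F (c t)).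
Proof.
move=> dF [dc cv].
have dct : differentiable c t by apply/derivable1_diffP.
have dFc : differentiable (F \o c) t by exact: differentiable_comp.
apply: DeriveDef; first exact: diff_derivable.
by rewrite deriveE // diff_comp //= -[X in 'd F _ X]deriveE // cv -deriveE.
Qed.

Lemma is_derive_segment F (p u : 'rV[R]_d) (t : R) :
  differentiable F (p + t *: u) ->
  is_derive t 1 (fun s => F (p + s *: u)) ('D_u F (p + t *: u)).
Proof.
move=> dF; apply: (@is_derive_curve F (fun s => p + s *: u)) => //.
have h : is_derive t 1 (fun s : R => s *: u) u.
  apply: DeriveDef; first exact/diff_derivable.
  by rewrite deriveE // diff_val scale1r.
apply: (@is_derive_eq _ _ _ _ _ _ _ (0 + u)); last by rewrite add0r.
Qed.

(** The mean value theorem, first in the direction u for the increment of F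
    along h v, then in the direction v for the derivative 'D_u F. *)
Lemma second_difference U F (x u v : 'rV[R]_d) (h : R) : Ck 2 U F -> 0 < h ->
  (forall s t, s \in `[0, h]%R -> t \in `[0, h]%R -> U (x + s *: u + t *: v)) ->
  exists s t, [/\ s \in `]0, h[%R, t \in `]0, h[%R &
    F (x + h *: u + h *: v) - F (x + h *: u) - F (x + h *: v) + F x =
    'D_v (fun y => 'D_u F y) (x + s *: u + t *: v) * h ^+ 2].
Proof.
move=> [dF DF] h0 inU.
have i0 : (0 : R) \in `[0, h]%R by rewrite in_itv /= lexx ltW.
have ih : h \in `[0, h]%R by rewrite in_itv /= lexx ltW.
pose f1 (r : R) := F (x + r *: u + h *: v) - F (x + r *: u).
pose df1 (r : R) := 'D_u F (x + r *: u + h *: v) - 'D_u F (x + r *: u).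
have der1 (r : R) : r \in `[0, h]%R -> is_derive r 1 f1 (df1 r).
  move=> rh; apply: is_deriveB.
    have -> : (fun r : R => F (x + r *: u + h *: v)) =
       (fun r => F (x + h *: v + r *: u)).
      by apply/funext => q; rewrite addrAC.
    rewrite addrAC; apply: is_derive_segment.
    by rewrite addrAC; apply: dF; exact: inU.
  apply: is_derive_segment.
  by rewrite -[X in differentiable _ X]addr0 -(scale0r v); apply: dF; exact: inU.
have D1 r : r \in `]0, h[%R -> is_derive r 1 f1 (df1 r).
  by move=> rh; apply: der1; exact: subset_itv_oo_cc rh.
have C1 : {within `[0, h], continuous f1}.
  apply: derivable_within_continuous => r rh.
  by have := der1 r rh => -[].
have [s sh e1] := @MVT R f1 df1 0 h h0 D1 C1.
have sh' : s \in `[0, h]%R by exact: subset_itv_oo_cc sh.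
pose f2 (r : R) := 'D_u F (x + s *: u + r *: v).
pose df2 (r : R) := 'D_v (fun y => 'D_u F y) (x + s *: u + r *: v).
have der2 (r : R) : r \in `[0, h]%R -> is_derive r 1 f2 (df2 r).
  move=> rh; apply: (@is_derive_segment (fun y => 'D_u F y)).
  by have [+ _] := DF u; apply; exact: inU.
have D2 r : r \in `]0, h[%R -> is_derive r 1 f2 (df2 r).
  by move=> rh; apply: der2; exact: subset_itv_oo_cc rh.
have C2 : {within `[0, h], continuous f2}.
  apply: derivable_within_continuous => r rh.
  by have := der2 r rh => -[].
have [t th e2] := @MVT R f2 df2 0 h h0 D2 C2.
rewrite /f2 /df2 /f1 /df1 !scale0r !addr0 !subr0 in e1 e2.
exists s, t; split => //.
transitivity (F (x + h *: u + h *: v) - F (x + h *: u) -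
   (F (x + h *: v) - F x)); first by ring.
by rewrite e1 e2; ring.
Qed.

(** The second difference over the parallelogram spanned by h u and h v does not
    see the order of u and v, while [second_difference] expresses it by either
    mixed derivative at a nearby point; let h tend to 0. *)
Lemma derive_comm U F (x u v : 'rV[R]_d) : open U -> U x -> Ck 2 U F ->
  'D_v (fun y => 'D_u F y) x = 'D_u (fun y => 'D_v F y) x.
Proof.
move=> oU Ux C2.
have [dF DF] := C2.
set A := 'D_v _ x; set B := 'D_u _ x.
apply/eqP; rewrite -subr_eq0 -normr_le0; apply/ler_addgt0Pr => e e0.
rewrite add0r.
have cA : {for x, continuous (fun y => 'D_v (fun y => 'D_u F y) y)}.
  by have [_ /(_ v) H] := DF u; exact: H.
have cB : {for x, continuous (fun y => 'D_u (fun y => 'D_v F y) y)}.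
  by have [_ /(_ u) H] := DF v; exact: H.
have e2 : 0 < e / 2 by rewrite divr_gt0.
have nU : \forall y \near x, U y by exact: (open_near oU Ux).
have nA : \forall y \near x, `|A - 'D_v (fun y => 'D_u F y) y| <= e / 2.
  by move/cvgrPdist_le : cA => /(_ _ e2).
have nB : \forall y \near x, `|B - 'D_u (fun y => 'D_v F y) y| <= e / 2.
  by move/cvgrPdist_le : cB => /(_ _ e2).
have near_x : \forall y \near x, [/\ U y,
   `|A - 'D_v (fun y => 'D_u F y) y| <= e / 2 &
   `|B - 'D_u (fun y => 'D_v F y) y| <= e / 2].
  by apply: filterS3 nU nA nB => y Uy yA yB; split.
have /nbhs_ballP[r /= r0 rball] := near_x.
(* small enough for the whole parallelogram to stay in the ball of radius r *)
pose m := `|u| + `|v| + 1.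
have m0 : 0 < m by rewrite /m; have := normr_ge0 u; have := normr_ge0 v; lra.
pose h := r / (2 * m).
have h0 : 0 < h by rewrite divr_gt0 // mulr_gt0.
have inB s t : s \in `[0, h]%R -> t \in `[0, h]%R ->
   ball x r (x + s *: u + t *: v).
  rewrite !in_itv /= => /andP[s0 sh] /andP[t0 th].
  rewrite -ball_normE /ball_ /= -addrA opprD addNKr normrN.
  apply: (le_lt_trans (ler_normD _ _)); rewrite !normrZ !ger0_norm //.
  have /ler_wpM2r -/(_ `|u| (normr_ge0 _)) H1 := sh.
  have /ler_wpM2r -/(_ `|v| (normr_ge0 _)) H2 := th.
  have hm : h * m = r / 2 by rewrite /h; field; rewrite gt_eqF.
  have : h * `|u| + h * `|v| + h = r / 2 by rewrite -hm /m; ring.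
  lra.
have [s1 [t1 [s1h t1h E1]]] := second_difference C2 h0
  (fun s t sh th => let: And3 H _ _ := rball _ (inB s t sh th) in H).
have inB' s t : s \in `[0, h]%R -> t \in `[0, h]%R ->
   ball x r (x + s *: v + t *: u) by move=> sh th; rewrite addrAC; exact: inB.
have [s2 [t2 [s2h t2h E2]]] := second_difference C2 h0
  (fun s t sh th => let: And3 H _ _ := rball _ (inB' s t sh th) in H).
have [|_ HA _] := rball (x + s1 *: u + t1 *: v).
  by apply: inB; exact: subset_itv_oo_cc.
have [|_ _ HB] := rball (x + s2 *: v + t2 *: u).
  by apply: inB'; exact: subset_itv_oo_cc.
have hh : h ^+ 2 != 0 by rewrite expf_neq0 // gt_eqF.
rewrite (addrAC x (h *: v)) in E2.
have Q a b c e' : a - b - c + e' = a - c - b + e' :> R by ring.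
rewrite Q in E1.
have EE : 'D_v (fun y => 'D_u F y) (x + s1 *: u + t1 *: v) =
          'D_u (fun y => 'D_v F y) (x + s2 *: v + t2 *: u).
  by apply: (mulIf hh); exact: (etrans (esym E1) E2).
move: HA HB; rewrite EE; set D := 'D_u _ _ => HA HB.
have -> : A - B = (A - D) - (B - D) by ring.
have tri := ler_normB (A - D) (B - D).
apply: (le_trans tri).
apply: (le_trans (lerD HA HB)).
by rewrite -splitr.
Qed.

End SmoothCalculus.

(** * The algebra of endomorphisms in coordinates *)

Section EndomorphismAlgebra.
Variables (R : realType) (V : vectType R).
Implicit Types (A B C D K L P : 'End(V)).

Local Notation N := (\dim {:'End(V)}).

Definition endo_base (i : 'I_N) : 'End(V) := (vbasis {:'End(V)})`_i.

Lemma endo_coordsD A B : endo_coords (A + B) = endo_coords A + endo_coords B.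
Proof. by apply/rowP => i; rewrite !mxE linearD. Qed.
Lemma endo_coordsN A : endo_coords (- A) = - endo_coords A.
Proof. by apply/rowP => i; rewrite !mxE linearN. Qed.
Lemma endo_coordsZ (k : R) A : endo_coords (k *: A) = k *: endo_coords A.
Proof. by apply/rowP => i; rewrite !mxE linearZ. Qed.
Lemma endo_coords_sum (I : Type) (r : seq I) (F : I -> 'End(V)) :
  endo_coords (\sum_(i <- r) F i) = \sum_(i <- r) endo_coords (F i).
Proof.
apply/rowP => i; rewrite summxE !mxE linear_sum.
by apply: eq_bigr => j _; rewrite !mxE.
Qed.

Lemma endo_coordsK (A : 'End(V)) :
  A = \sum_i endo_coords A 0 i *: endo_base i.
Proof. by rewrite -[LHS](passmx.rVofK (vbasisP {:'End(V)})). Qed.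

Lemma endo_coords_inj : injective (@endo_coords R V).
Proof. exact: can_inj (passmx.rVofK (vbasisP {:'End(V)})). Qed.

Definition endo_scalar (i : 'I_N) A : R := endo_coords A 0 i.

Lemma endo_eqP A B : (forall i, endo_scalar i A = endo_scalar i B) -> A = B.
Proof. by move=> AB; apply/endo_coords_inj/rowP => i; exact: AB. Qed.

Lemma endo_scalarD i A B : endo_scalar i (A + B) = endo_scalar i A + endo_scalar i B.
Proof. by rewrite /endo_scalar endo_coordsD mxE. Qed.
Lemma endo_scalarN i A : endo_scalar i (- A) = - endo_scalar i A.
Proof. by rewrite /endo_scalar endo_coordsN mxE. Qed.
Lemma endo_scalarZ i (k : R) A : endo_scalar i (k *: A) = k * endo_scalar i A.
Proof. by rewrite /endo_scalar endo_coordsZ mxE. Qed.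
Lemma endo_scalar0 i : endo_scalar i 0 = 0.
Proof. by rewrite -(scale0r 0) endo_scalarZ mul0r. Qed.

Definition endo_expand := (@comp_lfunDl R V V V, @comp_lfunDr R V V V,
  @comp_lfunNl R V V V, @comp_lfunNr R V V V,
  (fun k f g => esym (@comp_lfunZl R V V V k f g)),
  (fun k f g => esym (@comp_lfunZr R V V V k f g)),
  @comp_lfunA R V V V V, @comp_lfun1l R V V, @comp_lfun1r R V V,
  @comp_lfun0l R V V V, @comp_lfun0r R V V V).
Definition endo_scalarE := (endo_scalarD, endo_scalarN, endo_scalarZ, endo_scalar0).

End EndomorphismAlgebra.

(** Decides identities between noncommutative polynomials in endomorphisms:
    expand both sides into words, then compare coordinates, where each word is an
    atom of a commutative identity. Turning the atoms into variables keeps the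
    comparison fast but identifies only words that are syntactically equal; the
    fallback compares them up to conversion. *)
Ltac endo_ring :=
  rewrite /commutator /anticommutator ?endo_expand;
  apply: endo_eqP => ?; rewrite ?endo_scalarE;
  first [ solve [ repeat match goal with |- context [endo_scalar ?i ?w] =>
                    generalize (endo_scalar i w); intro end; ring ]
        | ring ].

Section EndomorphismNorm.
Variables (R : realType) (V : vectType R).
Implicit Types (A B C D K L P : 'End(V)).

Lemma comp_lfun_suml (I : Type) (r : seq I) (F : I -> 'End(V)) B :
  ((\sum_(i <- r) F i) \o B)%VF = \sum_(i <- r) (F i \o B)%VF.
Proof.
apply: (big_morph (fun X : 'End(V) => (X \o B)%VF)) => [X Y|].
  exact: comp_lfunDl.
exact: comp_lfun0l.
Qed.

Lemma comp_lfun_sumr (I : Type) (r : seq I) (F : I -> 'End(V)) B :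
  (B \o (\sum_(i <- r) F i))%VF = \sum_(i <- r) (B \o F i)%VF.
Proof.
apply: (big_morph (fun X : 'End(V) => (B \o X)%VF)) => [X Y|].
  exact: comp_lfunDr.
exact: comp_lfun0r.
Qed.

Lemma comp_endo_sum A B : (A \o B)%VF =
  \sum_i \sum_j (endo_scalar i A * endo_scalar j B) *:
    (endo_base i \o endo_base j)%VF :> 'End(V).
Proof.
rewrite {1}(endo_coordsK A) {1}(endo_coordsK B) comp_lfun_suml.
apply: eq_bigr => i _; rewrite comp_lfun_sumr.
apply: eq_bigr => j _.
by rewrite -comp_lfunZl -comp_lfunZr scalerA.
Qed.

Definition endo_norm A : R := `|endo_coords A|.

Lemma endo_normD A B : endo_norm (A + B) <= endo_norm A + endo_norm B.
Proof. by rewrite /endo_norm endo_coordsD ler_normD. Qed.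

Lemma endo_normN A : endo_norm (- A) = endo_norm A.
Proof. by rewrite /endo_norm endo_coordsN normrN. Qed.

Lemma endo_normZ k A : endo_norm (k *: A) = `|k| * endo_norm A.
Proof. by rewrite /endo_norm endo_coordsZ normrZ. Qed.

Lemma endo_norm_eq0 A : endo_norm A <= 0 -> A = 0.
Proof.
rewrite /endo_norm normr_le0 => /eqP A0; apply: endo_coords_inj.
by rewrite A0; apply/rowP => i; rewrite -[RHS]/(endo_scalar i 0) endo_scalar0 mxE.
Qed.

Lemma endo_scalar_le i A : `|endo_scalar i A| <= endo_norm A.
Proof.
rewrite /endo_norm [leRHS]/Num.Def.normr /= mx_normrE.
exact: (le_bigmax _ (fun ij => `|endo_coords A ij.1 ij.2|) (ord0, i)).
Qed.

(** The norms of the products of basis vectors add up to a bound; 1 is added to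
    make it positive. *)
Lemma endo_norm_comp : exists2 m : R, 0 < m & forall A B,
  endo_norm (A \o B)%VF <= m * (endo_norm A * endo_norm B).
Proof.
pose e i j := endo_norm ((endo_base i \o endo_base j)%VF : 'End(V)).
have e0 i j : 0 <= e i j by exact: normr_ge0.
exists (1 + \sum_i \sum_j e i j).
  apply: ltr_pwDl => //.
  by apply: sumr_ge0 => i _; exact: sumr_ge0.
move=> A B; rewrite mulrDl mul1r.
rewrite -[leLHS]add0r; apply: lerD; first by rewrite mulr_ge0 ?normr_ge0.
rewrite comp_endo_sum mulr_suml /endo_norm endo_coords_sum.
apply: le_trans (ler_norm_sum _ _ _) _; apply: ler_sum => i _.
rewrite endo_coords_sum mulr_suml.
apply: le_trans (ler_norm_sum _ _ _) _; apply: ler_sum => j _.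
rewrite endo_coordsZ normrZ mulrC normrM; apply: ler_wpM2l => //.
by apply: ler_pM => //; exact: endo_scalar_le.
Qed.

(** Convergence at 0 for the topology of End V transported by its coordinates. *)
Definition endo_cvg0 (f : R -> 'End(V)) (A : 'End(V)) : Prop :=
  endo_coords (f h) @[h --> 0^'] --> endo_coords A.

Lemma endo_cvg0_cst A : endo_cvg0 (fun=> A) A.
Proof. exact: cvg_cst. Qed.

Lemma endo_cvg0D (f1 f2 : R -> 'End(V)) A B : endo_cvg0 f1 A -> endo_cvg0 f2 B ->
  endo_cvg0 (fun h => f1 h + f2 h) (A + B).
Proof.
rewrite /endo_cvg0 endo_coordsD => H1 H2.
under eq_fun do rewrite endo_coordsD.
exact: cvgD.
Qed.

Lemma endo_cvg0N (f1 : R -> 'End(V)) A : endo_cvg0 f1 A ->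
  endo_cvg0 (fun h => - f1 h) (- A).
Proof.
rewrite /endo_cvg0 endo_coordsN => H1.
under eq_fun do rewrite endo_coordsN.
exact: cvgN.
Qed.

Lemma endo_cvg0_comp (f1 f2 : R -> 'End(V)) A B :
  endo_cvg0 f1 A -> endo_cvg0 f2 B ->
  endo_cvg0 (fun h => (f1 h \o f2 h)%VF) (A \o B)%VF.
Proof.
rewrite /endo_cvg0 comp_endo_sum => H1 H2.
have E (X Y : 'End(V)) : endo_coords (\sum_i \sum_j
   (endo_scalar i X * endo_scalar j Y) *: (endo_base i \o endo_base j)%VF) =
   \sum_i \sum_j (endo_scalar i X * endo_scalar j Y) *:
      endo_coords (endo_base i \o endo_base j)%VF.
  rewrite endo_coords_sum; apply: eq_bigr => i _.
  by rewrite endo_coords_sum; apply: eq_bigr => j _; rewrite endo_coordsZ.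
under eq_fun do rewrite comp_endo_sum E.
rewrite E.
have cvgS (f0 : R -> 'End(V)) (X : 'End(V)) :
    endo_coords (f0 h) @[h --> 0^'] --> endo_coords X ->
    forall i, endo_scalar i (f0 h) @[h --> (0:R)^'] --> endo_scalar i X.
  move=> H i; have := @coord_continuous R 1 _ 0 i (endo_coords X).
  exact: (@cvg_comp _ _ _ (fun h => endo_coords (f0 h)) (fun x => x 0 i)).
have addc : continuous (fun z : 'rV[R]_(\dim {:'End(V)}) * 'rV_(\dim {:'End(V)}) => z.1 + z.2).
  by move=> z; apply: cvgD; [exact: cvg_fst|exact: cvg_snd].
apply: (cvg_big addc) => i _; apply: (cvg_big addc) => j _.
apply: cvgZr_tmp; apply: cvgM; exact: cvgS.
Qed.

End EndomorphismNorm.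

(** * Adjoints, conjugation and reflections *)

Section Isometries.
Variables (R : realType) (V : vectType R) (g : {dot V for idfun}).
Implicit Types (A B C D : 'End(V)) (K L : twistor g) (u v w x y : V).

Lemma metricC u v : g u v = g v u.
Proof. by rewrite hermC expr0 mul1r. Qed.

Lemma metricDl u v w : g (u + v) w = g u w + g v w. Proof. exact: linearDl. Qed.
Lemma metricDr u v w : g w (u + v) = g w u + g w v. Proof. exact: linearDr. Qed.
Lemma metricNl u w : g (- u) w = - g u w. Proof. exact: linearNl. Qed.
Lemma metricNr u w : g w (- u) = - g w u. Proof. exact: linearNr. Qed.
Lemma metricZl k u w : g (k *: u) w = k * g u w. Proof. exact: linearZl_LR. Qed.
Lemma metricZr k u w : g w (k *: u) = k * g w u. Proof. exact: linearZr_LR. Qed.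
Lemma metric0l w : g 0 w = 0. Proof. exact: linear0l. Qed.
Lemma metric0r w : g w 0 = 0. Proof. exact: linear0r. Qed.
Definition metricE := (metricDl, metricDr, metricNl, metricNr,
  metricZl, metricZr, metric0l, metric0r).

Lemma metric_gt0 v : v != 0 -> 0 < g v v.
Proof. exact: neq0_dnorm_gt0. Qed.

Lemma metric_eq0 v : g v v = 0 -> v = 0.
Proof.
move=> gv; apply/eqP/negPn/negP => v0.
by have := metric_gt0 v0; rewrite gv ltxx.
Qed.

Definition is_adjoint A B := forall u v, g (A u) v = g u (B v).

Lemma adjoint_comp A A' B B' : is_adjoint A A' -> is_adjoint B B' ->
  is_adjoint (A \o B)%VF (B' \o A')%VF.
Proof. by move=> HA HB u v; rewrite !comp_lfunE HA HB. Qed.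

Lemma adjointD A A' B B' : is_adjoint A A' -> is_adjoint B B' ->
  is_adjoint (A + B) (A' + B').
Proof.
by move=> HA HB u v; rewrite !add_lfunE metricDl metricDr HA HB.
Qed.

Lemma adjointN A A' : is_adjoint A A' -> is_adjoint (- A) (- A').
Proof. by move=> HA u v; rewrite !opp_lfunE metricNl metricNr HA. Qed.

Lemma adjointZ (k : R) A A' : is_adjoint A A' -> is_adjoint (k *: A) (k *: A').
Proof.
by move=> HA u v; rewrite !scale_lfunE metricZl metricZr HA.
Qed.

Lemma adjoint1 : is_adjoint \1%VF \1%VF.
Proof. by move=> u v; rewrite !id_lfunE. Qed.

Lemma adjoint0 : is_adjoint 0 0.
Proof. by move=> u v; rewrite !zero_lfunE metric0l metric0r. Qed.

Lemma skewP A : orthogonal_algebra g A <-> is_adjoint A (- A).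
Proof.
split=> [oA u v|HA u v]; last by rewrite HA opp_lfunE metricNr addNr.
by rewrite opp_lfunE metricNr; apply/eqP; rewrite -subr_eq0 opprK; apply/eqP/oA.
Qed.

Lemma twistor_sqrE K : (K \o K)%VF = - \1%VF :> 'End(V).
Proof. exact: twistor_sqr. Qed.

Lemma twistorKK K x : K (K x) = - x.
Proof. by rewrite -comp_lfunE twistor_sqrE opp_lfunE id_lfunE. Qed.

Lemma twistor_adjoint K : is_adjoint K (- (K : 'End(V))).
Proof.
move=> u v; have := twistor_isometry K (K u) v.
by rewrite (twistorKK K u) metricNl opp_lfunE metricNr => ->.
Qed.

Lemma twistor_skew K : orthogonal_algebra g K.
Proof. by apply/skewP; exact: twistor_adjoint. Qed.

Lemma twistor_form K u v : g (K u) v = - g u (K v).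
Proof. by rewrite twistor_adjoint opp_lfunE metricNr. Qed.

Lemma twistor_ortho K u : g u (K u) = 0.
Proof.
have := twistor_form K u u; rewrite metricC => /eqP.
by rewrite -subr_eq0 opprK -mulr2n mulrn_eq0 /= => /eqP.
Qed.

Lemma twistor_inj K L : (K : 'End(V)) = L -> K = L.
Proof.
case: K => K HK1 HK2; case: L => L HL1 HL2 /= KL.
by subst L; congr Twistor; exact: Prop_irrelevance.
Qed.

Section Conjugate.
Variables (A B : 'End(V)).
Hypotheses (AB : (A \o B)%VF = \1%VF) (BA : (B \o A)%VF = \1%VF).
Hypothesis isoA : forall u v, g (A u) (A v) = g u v.

Let AK x : A (B x) = x. Proof. by rewrite -comp_lfunE AB id_lfunE. Qed.
Let BK x : B (A x) = x. Proof. by rewrite -comp_lfunE BA id_lfunE. Qed.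

Fact conj_twistor_sqr K :
  ((A \o K \o B) \o (A \o K \o B))%VF = - \1%VF :> 'End(V).
Proof.
apply/lfunP => x; rewrite opp_lfunE id_lfunE !comp_lfunE BK twistorKK.
by rewrite linearN /= AK.
Qed.

Fact conj_twistor_isometry K u v :
  g ((A \o K \o B)%VF u) ((A \o K \o B)%VF v) = g u v.
Proof.
rewrite !comp_lfunE isoA twistor_isometry.
by rewrite -isoA !AK.
Qed.

Definition conj_twistor K : twistor g :=
  Twistor (conj_twistor_sqr K) (conj_twistor_isometry K).

End Conjugate.

Definition reflection v : 'End(V) :=
  linfun (fun x => x - (2 * g x v / g v v) *: v).

Lemma reflectionE v x : reflection v x = x - (2 * g x v / g v v) *: v.
Proof.
pose f x := x - (2 * g x v / g v v) *: v.
have lf : linear f.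
  move=> a y z; rewrite /f metricDl metricZl mulrDr !mulrDl scalerDl opprD !scalerBr.
  rewrite addrACA; congr (_ + _ + _); rewrite !scalerA; congr (- (_ *: _)); ring.
pose fl : {linear V -> V} := HB.pack f (GRing.isLinear.Build _ _ _ _ _ lf).
by rewrite /reflection -/f -[f]/(fl : V -> V) lfunE.
Qed.

Lemma reflection_id v x : g x v = 0 -> reflection v x = x.
Proof. by move=> xv; rewrite reflectionE xv mulr0 mul0r scale0r subr0. Qed.

Lemma reflectionK v : v != 0 -> (reflection v \o reflection v)%VF = \1%VF.
Proof.
move=> v0; apply/lfunP => x; rewrite comp_lfunE id_lfunE !reflectionE.
have gv : g v v != 0 by rewrite gt_eqF // metric_gt0.
rewrite !metricE -addrA -opprD -scalerDl.
rewrite [X in X *: v](_ : _ = 0) ?scale0r ?subr0 //; field.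
exact: gv.
Qed.

Lemma reflection_isometry v x y : v != 0 ->
  g (reflection v x) (reflection v y) = g x y.
Proof.
move=> v0; rewrite !reflectionE.
have gv : g v v != 0 by rewrite gt_eqF // metric_gt0.
rewrite !metricE (metricC v y); field.
exact: gv.
Qed.

Lemma reflection_swap x y : g x x = g y y -> reflection (x - y) x = y.
Proof.
have [->|xy] := eqVneq x y.
  by rewrite subrr reflectionE metric0r mulr0 mul0r scale0r subr0.
move=> gxy; rewrite reflectionE.
have v0 : g (x - y) (x - y) != 0.
  by rewrite gt_eqF // metric_gt0 // subr_eq0.
suff -> : 2 * g x (x - y) / g (x - y) (x - y) = 1 by rewrite scale1r opprB addrC subrK.
apply: (mulIf v0); rewrite mulfVK // mul1r.
rewrite !metricE (metricC y x) -gxy; ring.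
Qed.

Definition reflected v (v0 : v != 0) K : twistor g :=
  conj_twistor (reflectionK v0) (reflectionK v0)
    (fun x y => reflection_isometry x y v0) K.

End Isometries.

(** * Skew endomorphisms commuting with a complex structure *)

(** A subspace of maximal dimension among those inside P absorbs every point
    of P. *)
Lemma linear_closed_vspace (F : fieldType) (vT : vectType F) (P : set vT) :
  P 0 -> (forall (k : F) x y, P x -> P y -> P (k *: x + y)) ->
  exists U : {vspace vT}, forall x, P x <-> x \in U.
Proof.
move=> P0 PD.
pose Q d := `[< exists2 U : {vspace vT}, \dim U = d & forall x, x \in U -> P x >].
have exQ : exists d, Q d.
  by exists 0%N; apply/asboolP; exists 0%VS; rewrite ?dimv0 // => x /[!memv0]/eqP ->.
have bQ d : Q d -> (d <= \dim {:vT})%N.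
  by move=> /asboolP[U <- _]; apply: dimvS; exact: subvf.
have [d /asboolP[U dU UP] dmax] := ex_maxnP exQ bQ.
exists U => x; split; last exact: UP.
move=> Px.
have : (\dim (U + <[x]>)%VS <= d)%N.
  apply: dmax; apply/asboolP; exists (U + <[x]>)%VS => // y.
  move=> /memv_addP[y1 y1U [_ /vlineP[k ->] ->]].
  by rewrite addrC; apply: PD => //; exact: UP.
rewrite -dU => dle; suff -> : U = (U + <[x]>)%VS.
  by apply: (subvP (addvSr _ _)); exact: memv_line.
by apply/eqP; rewrite eqEdim addvSl.
Qed.

Section UnitaryAlgebra.
Variables (R : realType) (V : vectType R) (g : {dot V for idfun}).
Implicit Types (A B C D Z W : 'End(V)) (K L : twistor g) (u v w x y : V).

Lemma skewD (k : R) A B : orthogonal_algebra g A -> orthogonal_algebra g B ->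
  orthogonal_algebra g (k *: A + B).
Proof.
move=> /skewP sA /skewP sB; apply/skewP; rewrite opprD -scalerN.
by apply: adjointD => //; exact: adjointZ.
Qed.

Lemma skew0 : orthogonal_algebra g 0.
Proof. by apply/skewP; rewrite oppr0; exact: adjoint0. Qed.

Lemma skewN A : orthogonal_algebra g A -> orthogonal_algebra g (- A).
Proof.
by move=> sA; have := skewD (-1) sA skew0; rewrite scaleN1r addr0.
Qed.

Lemma skew_add A B : orthogonal_algebra g A -> orthogonal_algebra g B ->
  orthogonal_algebra g (A + B).
Proof. by move=> sA sB; have := skewD 1 sA sB; rewrite scale1r. Qed.

Lemma skew_commutator A B : orthogonal_algebra g A -> orthogonal_algebra g B ->
  orthogonal_algebra g (commutator A B).
Proof.
move=> /skewP sA /skewP sB; apply/skewP.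
have -> : - commutator A B = (((- B) \o (- A)) - ((- A) \o (- B)))%VF by endo_ring.
by apply: adjointD; [|apply: adjointN]; exact: adjoint_comp.
Qed.

Definition commuting_skew (K : 'End(V)) : set 'End(V) :=
  [set A | orthogonal_algebra g A /\ (A \o K)%VF = (K \o A)%VF].

Lemma skew_sandwich Z W A : is_adjoint g Z W -> orthogonal_algebra g A ->
  orthogonal_algebra g (Z \o A \o W)%VF.
Proof.
move=> ZW /skewP sA; apply/skewP.
have -> : - (Z \o A \o W)%VF = (Z \o ((- A) \o W))%VF by endo_ring.
have WZ : is_adjoint g W Z by move=> x y; rewrite metricC -ZW metricC.
by apply: adjoint_comp => //; exact: adjoint_comp.
Qed.

Lemma commuting_skew_sandwich Z W (K L : 'End(V)) A : is_adjoint g Z W ->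
  (L \o Z)%VF = (Z \o K)%VF -> (K \o W)%VF = (W \o L)%VF ->
  commuting_skew K A -> commuting_skew L (Z \o A \o W)%VF.
Proof.
move=> ZW LZ KW [sA AK]; split; first exact: skew_sandwich.
by rewrite -comp_lfunA -KW comp_lfunA -(comp_lfunA Z A K) AK !comp_lfunA LZ.
Qed.

Lemma commuting_skew_vspace (K : 'End(V)) :
  exists U : {vspace 'End(V)}, forall A, commuting_skew K A <-> A \in U.
Proof.
apply: linear_closed_vspace => [|k A B [sA AK] [sB BK]].
  by split; [exact: skew0|rewrite comp_lfun0l comp_lfun0r].
split; first exact: skewD.
by rewrite comp_lfunDl comp_lfunDr -comp_lfunZl -comp_lfunZr AK BK.
Qed.

Lemma sandwich_linear Z W : linear (fun A : 'End(V) => (Z \o A \o W)%VF).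
Proof. by move=> k A B; endo_ring. Qed.

Definition sandwich Z W : 'End('End(V)) := linfun (HB.pack
  (fun A : 'End(V) => (Z \o A \o W)%VF)
  (GRing.isLinear.Build _ _ _ _ _ (sandwich_linear Z W)) :
  {linear 'End(V) -> 'End(V)}).

Lemma sandwichE Z W A : sandwich Z W A = (Z \o A \o W)%VF.
Proof. by rewrite lfunE. Qed.

Lemma sandwich_inj Z W : lker Z == 0%VS -> lker W == 0%VS ->
  lker (sandwich Z W) == 0%VS.
Proof.
move=> Z0 W0; apply/lker0P => A B; rewrite !sandwichE => E.
rewrite -(lker0_compKf Z0 A) -(lker0_compKf Z0 B); congr (_ \o _)%VF.
by rewrite -(lker0_compfK W0 (Z \o A)%VF) E lker0_compfK.
Qed.

Lemma lker0_left_inv A B : (B \o A)%VF = \1%VF -> lker A == 0%VS.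
Proof.
move=> BA; apply/lker0P => x y Axy.
by rewrite -[x]id_lfunE -BA comp_lfunE Axy -comp_lfunE BA id_lfunE.
Qed.

Lemma reflected_dim v (v0 : v != 0) K (U U' : {vspace 'End(V)}) :
  (forall A, commuting_skew K A <-> A \in U) ->
  (forall A, commuting_skew (reflected v0 K) A <-> A \in U') ->
  \dim U = \dim U'.
Proof.
set r := reflection g v; have rr : (r \o r)%VF = \1%VF by exact: reflectionK.
have radj : is_adjoint g r r.
  move=> x y; rewrite -(reflection_isometry g _ y v0) -/r -!comp_lfunE.
  by rewrite comp_lfunE -[r (r x)]comp_lfunE rr id_lfunE.
have inj := sandwich_inj (lker0_left_inv rr) (lker0_left_inv rr).
have rK : (r \o (r \o K \o r) = K \o r)%VF by rewrite !comp_lfunA rr comp_lfun1l.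
have Kr : ((r \o K \o r) \o r = r \o K)%VF by rewrite -!comp_lfunA rr comp_lfun1r.
move=> HU HU'; apply/eqP; rewrite eqn_leq; apply/andP; split.
  rewrite -(limg_dim_eq (f := sandwich r r) (U := U)); last by rewrite (eqP inj) capv0.
  apply: dimvS; apply/subvP => _ /memv_imgP[A AU ->].
  apply/HU'; rewrite sandwichE; apply: (commuting_skew_sandwich (K := K)) => //.
  exact/HU.
rewrite -(limg_dim_eq (f := sandwich r r) (U := U')); last by rewrite (eqP inj) capv0.
apply: dimvS; apply/subvP => _ /memv_imgP[A AU ->].
apply/HU; rewrite sandwichE; apply: (commuting_skew_sandwich (K := reflected v0 K)) => //.
exact/HU'.
Qed.

(** The subspace on which two twistors coincide; its dimension measures the
    progress of the induction in [commuting_skew_dim]. *)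
Definition agreement K L : {vspace V} := lker (twistor_endo K - twistor_endo L).

Lemma agreementP K L x : (x \in agreement K L) = (K x == L x).
Proof. by rewrite memv_ker add_lfunE opp_lfunE subr_eq0. Qed.

(** Induction on the codimension of the space W where K and L agree. If
    K w <> L w, conjugate K by the reflection exchanging K w and L w. The vector
    K w - L w is orthogonal to w, because K and L are skew, and to W, because
    g(x, K w - L w) = - g(K x - L x, w). So the reflection fixes w and W, and the
    conjugate agrees with L on W and at w. *)
Lemma commuting_skew_dim K L (U U' : {vspace 'End(V)}) :
  (forall A, commuting_skew K A <-> A \in U) ->
  (forall A, commuting_skew L A <-> A \in U') ->
  \dim U = \dim U'.
Proof.
move=> + HU'.
have [m le_m] : exists m, (\dim {:V} - \dim (agreement K L) < m)%N.
  by exists (\dim {:V} - \dim (agreement K L)).+1.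
elim: m K U le_m => // m IH K U le_m HU.
have [KL|KL] := pselect ((K : 'End(V)) = L).
  congr (\dim _); apply/vspaceP => A.
  apply/idP/idP => [/HU|/HU'] cA; last by apply/HU; rewrite KL.
  by apply/HU'; rewrite -KL.
have [w Kw] : exists w, K w != L w.
  apply: contrapT => KLw; apply: KL; apply/lfunP => x.
  by apply/eqP/negPn/negP => Kx; apply: KLw; exists x.
have v0 : K w - L w != 0 by rewrite subr_eq0.
have orth x : K x = L x -> g x (K w - L w) = 0.
  by move=> KLx; rewrite !metricE -[g x (K w)]opprK -[g x (L w)]opprK -!twistor_form KLx subrr.
have [U1 HU1] := commuting_skew_vspace (reflected v0 K).
rewrite (reflected_dim HU HU1); apply: (IH _ _ _ HU1).
rewrite -ltnS; apply: leq_trans le_m.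
set K' := reflected v0 K.
have K'E x : K' x = reflection g (K w - L w) (K (reflection g (K w - L w) x)).
  by rewrite /K' /= !comp_lfunE.
have lt_ker : (\dim (agreement K L) < \dim (agreement K' L))%N.
  have sub : (agreement K L <= agreement K' L)%VS.
    apply/subvP => x; rewrite !agreementP => /eqP KLx; apply/eqP.
    rewrite K'E (reflection_id (orth x KLx)) reflection_id //.
    by apply: orth; rewrite {2}KLx !twistorKK.
  rewrite ltn_neqAle dimvS // andbT; apply/negP => /eqP dE.
  have /eqP E : (agreement K L == agreement K' L)%VS.
    by rewrite eqEdim sub dE leqnn.
  move: (Kw); rewrite -agreementP E agreementP => /negP; apply; apply/eqP.
  rewrite K'E (reflection_id (x := w)); last first.
    by rewrite !metricE !twistor_ortho subrr.
  by apply: reflection_swap; rewrite !twistor_isometry.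
apply: ltn_sub2l => //; apply: leq_trans lt_ker _.
by apply: dimvS; exact: subvf.
Qed.

End UnitaryAlgebra.

(** * Twistors that do not commute with a given one *)

Section NonCommuting.
Variables (R : realType) (V : vectType R) (g : {dot V for idfun}).
Implicit Types (K L : twistor g) (u v w x y : V).

Lemma exists_orthogonal (U : {vspace V}) x y : (2 < \dim U)%N ->
  exists u, [/\ u != 0, g u x = 0 & g u y = 0].
Proof.
move=> dU; pose W := (U :&: orthov g <[x]> :&: orthov g <[y]>)%VS.
have W0 : W != 0%VS.
  rewrite -dimv_eq0 -lt0n.
  have := leq_dim_orthov1 g y (U :&: orthov g <[x]>)%VS.
  have := leq_dim_orthov1 g x U.
  rewrite -/W; lia.
exists (vpick W); split; first by rewrite vpick0.
  have := memv_pick W; rewrite !memv_cap => /andP[/andP[_]].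
  by rewrite mem_orthov1 => /eqP.
have := memv_pick W; rewrite !memv_cap => /andP[_].
by rewrite mem_orthov1 => /eqP.
Qed.

(** Conjugating K by the reflection in v changes its sign on the K-line of v
    only. With u orthogonal to that line, conjugating the result K1 by the
    reflection in w = v + u changes the sign of K1 on the plane spanned by w and
    K1 w, which is not K-stable; commutation with K would force the reflected
    vector of v - u to be u - v, that is v - u proportional to v + u. *)
Lemma exists_noncommuting_twistor K : (2 < \dim {:V})%N ->
  exists L, (K \o L)%VF <> (L \o K)%VF.
Proof.
move=> dV.
have [v [v0 _ _]] := exists_orthogonal 0 0 dV.
have [u [u0 uv uKv]] := exists_orthogonal v (K v) dV.
pose K1 := reflected v0 K.
have reflectedE w (w0 : w != 0) L x : reflected w0 L x =
    reflection g w (L (reflection g w x)) by rewrite /= !comp_lfunE.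
have rv : reflection g v v = - v.
  rewrite reflectionE mulfK ?gt_eqF ?metric_gt0 // scaler_nat mulr2n opprD.
  by rewrite addNKr.
have Kuv : g (K u) v = 0 by rewrite twistor_form uKv oppr0.
have K1v : K1 v = - K v.
  rewrite reflectedE rv linearN reflection_id // metricE twistor_form.
  by rewrite twistor_ortho !oppr0.
have K1Kv : K1 (K v) = v.
  rewrite reflectedE (reflection_id (x := K v)); last first.
    by rewrite twistor_form twistor_ortho oppr0.
  by rewrite twistorKK linearN /= rv opprK.
have K1u : K1 u = K u by rewrite reflectedE !reflection_id.
have K1Ku : K1 (K u) = - u.
  rewrite reflectedE (reflection_id Kuv) twistorKK reflection_id //.
  by rewrite metricE uv oppr0.
pose w := v + u.
have w0 : w != 0.
  apply/negP => /eqP w0; have := metric_gt0 g v0.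
  have -> : v = - u by apply/eqP; rewrite -addr_eq0; apply/eqP.
  by rewrite {2}(_ : - u = v) ?metricE ?uv ?oppr0 ?ltxx //; apply/esym/eqP;
     rewrite -addr_eq0; apply/eqP.
have [K2 K2E] : exists K2 : twistor g, forall x,
    K2 x = reflection g w (K1 (reflection g w x)).
  by exists (reflected w0 K1) => x; exact: reflectedE.
have rw : reflection g w w = - w.
  rewrite reflectionE mulfK ?gt_eqF ?metric_gt0 // scaler_nat mulr2n opprD.
  by rewrite addNKr.
exists K2 => KK2.
have K2w : K2 w = - K1 w.
  rewrite K2E rw linearN reflection_id // metricNl twistor_form.
  by rewrite twistor_ortho !oppr0.
have K2Kw : K2 (K w) = reflection g w (v - u).
  rewrite K2E (reflection_id (x := K w)); last by rewrite twistor_form twistor_ortho oppr0.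
  by rewrite linearD linearD /= K1Kv K1Ku.
have : (K \o K2)%VF w = (K2 \o K)%VF w by rewrite KK2.
rewrite !comp_lfunE K2w K2Kw linearN linearD /= K1v K1u linearD linearN /= !twistorKK.
rewrite opprK reflectionE; set c := (_ / _) => E.
have gv := metric_gt0 g v0; have gu := metric_gt0 g u0.
have cv : c = 2.
  have := congr1 (g v) E; rewrite /w !metricE (metricC g v u) uv => H.
  by apply: (mulIf (lt0r_neq0 gv)); lra.
have cu : c = - 2.
  have := congr1 (g u) E; rewrite /w !metricE uv => H.
  by apply: (mulIf (lt0r_neq0 gu)); lra.
lra.
Qed.

End NonCommuting.

(** * Cayley curves in the twistor space *)

Section Cayley.
Variables (R : realType) (V : vectType R) (g : {dot V for idfun}).
Implicit Types (A B C D : 'End(V)) (K L : twistor g) (u v w x y : V).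

(** A skew endomorphism has no nonzero real eigenvalue: if z = s C z then
    g(z, z) = s g(C z, z) = 0. *)
Lemma skew_resolvent C (s : R) : orthogonal_algebra g C ->
  lker (\1%VF - s *: C) == 0%VS.
Proof.
move=> sC; apply/lker0P => x y.
rewrite !add_lfunE !id_lfunE !opp_lfunE !scale_lfunE => E.
have E2 : x - y = s *: C (x - y).
  apply/eqP; rewrite -subr_eq0; apply/eqP.
  transitivity ((x - s *: C x) - (y - s *: C y)); last by rewrite E subrr.
  by rewrite linearB scalerBr /= !opprD !opprK addrACA.
apply/eqP; rewrite -subr_eq0; apply/eqP.
apply: (metric_eq0 (g := g)).
have := sC (x - y) (x - y); rewrite [in X in _ + X]metricC => H.
have gC0 : g (C (x - y)) (x - y) = 0 by lra.
by rewrite {1}E2 metricZl gC0 mulr0.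
Qed.

Definition resolvent C (s : R) : 'End(V) := ((\1%VF - s *: C)^-1)%VF.

Definition cayley C (t : R) : 'End(V) :=
  ((\1%VF + (t / 2) *: C) \o resolvent C (t / 2))%VF.

Variable C : 'End(V).
Hypothesis sC : orthogonal_algebra g C.

Lemma resolventK s : (resolvent C s \o (\1%VF - s *: C))%VF = \1%VF.
Proof. exact: lker0_compVf (skew_resolvent s sC). Qed.

Lemma resolventVK s : ((\1%VF - s *: C) \o resolvent C s)%VF = \1%VF.
Proof. exact: lker0_compfV (skew_resolvent s sC). Qed.

Lemma resolventNVK s : ((\1%VF + s *: C) \o resolvent C (- s))%VF = \1%VF.
Proof. by rewrite -[RHS](resolventVK (- s)) scaleNr opprK. Qed.

Lemma cayley_inv t : (cayley C t \o cayley C (- t))%VF = \1%VF.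
Proof.
rewrite /cayley !mulNr scaleNr -comp_lfunA (comp_lfunA (resolvent C (t / 2))).
by rewrite resolventK comp_lfun1l resolventNVK.
Qed.

Lemma cayley_invN t : (cayley C (- t) \o cayley C t)%VF = \1%VF.
Proof. by have := cayley_inv (- t); rewrite opprK. Qed.

Lemma cayley_isometry t u v : g (cayley C t u) (cayley C t v) = g u v.
Proof.
set s := t / 2.
have res x : x = (\1%VF - s *: C) (resolvent C s x).
  by rewrite -comp_lfunE resolventVK id_lfunE.
rewrite {2}(res u) {2}(res v) /cayley -/s !comp_lfunE.
set a := resolvent C s u; set b := resolvent C s v.
rewrite !add_lfunE !id_lfunE !opp_lfunE !scale_lfunE !metricE.
have /eqP := sC a b; rewrite addr_eq0 => /eqP ->; ring.
Qed.

Lemma resolvent_comm s A : (A \o C)%VF = (C \o A)%VF ->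
  (A \o resolvent C s)%VF = (resolvent C s \o A)%VF.
Proof.
move=> cAC.
have H : (A \o (\1%VF - s *: C))%VF = ((\1%VF - s *: C) \o A)%VF.
  by rewrite comp_lfunDr comp_lfunDl comp_lfunNr comp_lfunNl -comp_lfunZr
    -comp_lfunZl cAC comp_lfun1l comp_lfun1r.
rewrite -[LHS]comp_lfun1l -(resolventK s) -!comp_lfunA; congr (_ \o _)%VF.
by rewrite comp_lfunA -H -comp_lfunA resolventVK comp_lfun1r.
Qed.

Lemma cayley_comm t A : (A \o C)%VF = (C \o A)%VF ->
  (A \o cayley C t)%VF = (cayley C t \o A)%VF.
Proof.
move=> cAC; rewrite /cayley -comp_lfunA -(resolvent_comm (t / 2) cAC) !comp_lfunA.
congr (_ \o _)%VF.
by rewrite comp_lfunDr comp_lfunDl -comp_lfunZr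
    -comp_lfunZl cAC comp_lfun1l comp_lfun1r.
Qed.

Lemma cayleyE t : cayley C t = \1%VF + t *: (C \o resolvent C (t / 2))%VF.
Proof.
rewrite -[X in X + _](resolventVK (t / 2)) /cayley.
rewrite !comp_lfunDl comp_lfunNl -!comp_lfunZl -addrA; congr (_ + _).
by rewrite -scaleNr -scalerDl; congr (_ *: _); lra.
Qed.

(** From M = 1 + (h / 2) C M the norm of 1 - M is at most |h| |C| |M| / 2, up to
    the constant of [endo_norm_comp]; as |M| <= |1| + |1 - M|, for small h this
    absorbs |1 - M| and leaves a bound linear in |h|. *)
Lemma resolvent_cvg : endo_cvg0 (fun h => resolvent C (h / 2)) \1%VF.
Proof.
have [m m0 mP] := endo_norm_comp V.
set q := m * (endo_norm C * endo_norm (\1%VF : 'End(V))).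
have q0 : 0 <= q by rewrite !mulr_ge0 ?normr_ge0 // ltW.
have arith (t k a b c : R) : 0 <= t -> 0 <= k -> 0 <= a -> t * (m * k) <= 1 ->
    a <= t / 2 * (m * (k * b)) -> b <= c + a -> a <= t * (m * (k * c)).
  move=> t0 k0 a0; set l := t * (m * k) => l1.
  have -> : t / 2 * (m * (k * b)) = l * b / 2 by rewrite /l; field.
  have -> : t * (m * (k * c)) = l * c by rewrite /l; ring.
  have l0 : 0 <= l by rewrite !mulr_ge0 // ltW.
  move=> ab /(ler_wpM2l l0) bc.
  have : l * a <= a by rewrite -[leRHS]mul1r ler_wpM2r.
  move: bc; rewrite mulrDr; lra.
have small h : `|h| * (m * endo_norm C) <= 1 ->
    endo_norm (\1%VF - resolvent C (h / 2)) <= `|h| * q.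
  move=> hs; set M := resolvent C (h / 2).
  have ME : \1%VF - M = - ((h / 2) *: (C \o M)%VF).
    rewrite -[X in X - M](resolventVK (h / 2)) -/M comp_lfunDl comp_lfun1l.
    by rewrite comp_lfunNl -comp_lfunZl addrAC subrr add0r.
  have nN : endo_norm (\1%VF - M) <= `|h| / 2 * (m * (endo_norm C * endo_norm M)).
    rewrite {1}ME endo_normN endo_normZ normrM (ger0_norm (_ : 0 <= 2^-1)) //.
    by apply: ler_wpM2l (mP C M); rewrite mulr_ge0.
  have nM : endo_norm M <= endo_norm (\1%VF : 'End(V)) + endo_norm (\1%VF - M).
    have {1}-> : M = \1%VF + - (\1%VF - M) by rewrite opprB addrC subrK.
    by apply: le_trans (endo_normD _ _) _; rewrite endo_normN.
  by apply: arith hs nN nM; rewrite // /endo_norm // ltW.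
apply/cvgrPdist_le => e e0.
have k1 : 0 < m * endo_norm C + 1 by rewrite ltr_wpDl // mulr_ge0 ?normr_ge0 // ltW.
have q1 : 0 < q + 1 by rewrite ltr_wpDl.
near=> h.
have h1 : `|h| <= (m * endo_norm C + 1)^-1.
  by near: h; apply: dnbhs0_le; rewrite invr_gt0.
have h2 : `|h| <= e / (q + 1).
  by near: h; apply: dnbhs0_le; rewrite divr_gt0.
rewrite -endo_coordsN -endo_coordsD -/(endo_norm _).
apply: le_trans (small h _) _.
  have := ler_wpM2r (ltW k1) h1; rewrite mulVf ?gt_eqF // mulrDr mulr1.
  by have := normr_ge0 h; lra.
have := ler_wpM2r (ltW q1) h2; rewrite mulfVK ?gt_eqF // mulrDr mulr1.
by have := normr_ge0 h; lra.
Unshelve. all: by end_near. Qed.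

End Cayley.

Section CayleyCurve.
Variables (R : realType) (V : vectType R) (g : {dot V for idfun}).
Implicit Types (K L : twistor g).
Variable C : 'End(V).
Hypothesis sC : orthogonal_algebra g C.

Lemma endo_cvg0Z (f : R -> 'End(V)) A : endo_cvg0 f A ->
  endo_cvg0 (fun h => h *: f h) 0.
Proof.
rewrite /endo_cvg0 => H.
have -> : endo_coords (0 : 'End(V)) = (0 : R) *: endo_coords A.
  by rewrite -endo_coordsZ scale0r.
under eq_fun do rewrite endo_coordsZ.
by apply: cvgZ => //; exact: nbhs_dnbhs.
Qed.

Lemma resolvent_cvgN : endo_cvg0 (fun h => resolvent C (- h / 2)) \1%VF.
Proof.
have := resolvent_cvg (skewN sC); congr endo_cvg0; apply/funext => h.
by rewrite /resolvent mulNr scaleNr scalerN.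
Qed.

Definition cayley_curve K (t : R) : twistor g :=
  conj_twistor (cayley_inv sC t) (cayley_invN sC t) (cayley_isometry sC t) K.

Lemma cayley0 : cayley C 0 = \1%VF.
Proof. by rewrite (cayleyE sC) scale0r addr0. Qed.

Lemma cayley_curve0 K : cayley_curve K 0 = K.
Proof.
by apply: twistor_inj; rewrite /= oppr0 cayley0 comp_lfun1l comp_lfun1r.
Qed.

(** With R_t = 1 + t X_t, X_t = C (1 - t C / 2)^-1 and R_t^-1 = 1 - t Y_t, where
    Y_t = X_(-t), the slope of the curve is X_t K R_t^-1 - K Y_t, which tends to
    C K - K C. *)
Lemma is_derive_cayley_curve K :
  is_derive (0 : R) (1 : R) (fun t => endo_coords (cayley_curve K t))
    (endo_coords (commutator C K)).
Proof.
suff H : h^-1 *: (endo_coords (cayley_curve K (h *: 1 + 0)) -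
    endo_coords (cayley_curve K 0)) @[h --> (0 : R)^'] -->
    endo_coords (commutator C K).
  by apply: DeriveDef; [apply/cvg_ex; eexists; exact: H|exact: cvg_lim H].
pose X h := (C \o resolvent C (h / 2))%VF.
pose Y h := (C \o resolvent C (- h / 2))%VF.
pose slope h := (((X h \o K) \o (\1 + - (h *: Y h))) + - (K \o Y h))%VF.
have slopeE h : h != 0 -> h^-1 *: (endo_coords (cayley_curve K (h *: 1 + 0)) -
    endo_coords (cayley_curve K 0)) = endo_coords (slope h).
  move=> h0; rewrite -endo_coordsN -endo_coordsD -endo_coordsZ; congr endo_coords.
  rewrite cayley_curve0 /= [h *: 1]mulr1 addr0 !(cayleyE sC).
  rewrite -/(X h) -/(Y h) -[RHS]scale1r -(mulVf h0) -scalerA; congr (_ *: _).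
  by rewrite /slope; endo_ring.
have X1 : endo_cvg0 X (C \o \1)%VF.
  by apply: endo_cvg0_comp; [exact: endo_cvg0_cst|exact: resolvent_cvg].
have Y1 : endo_cvg0 Y (C \o \1)%VF.
  by apply: endo_cvg0_comp; [exact: endo_cvg0_cst|exact: resolvent_cvgN].
have slope1 : endo_cvg0 slope (commutator C K).
  have -> : commutator C K = ((((C \o \1) \o K) \o (\1 + - 0)) + - (K \o (C \o \1)))%VF.
    by endo_ring.
  apply: endo_cvg0D; last first.
    by apply: endo_cvg0N; apply: endo_cvg0_comp => //; exact: endo_cvg0_cst.
  apply: endo_cvg0_comp; first by apply: endo_cvg0_comp => //; exact: endo_cvg0_cst.
  apply: endo_cvg0D; first exact: endo_cvg0_cst.
  by apply: endo_cvg0N; exact: endo_cvg0Z Y1.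
apply: cvg_trans slope1; apply: near_eq_cvg.
by near=> h; rewrite slopeE //; near: h; exact: nbhs_dnbhs_neq.
Unshelve. all: by end_near. Qed.

End CayleyCurve.

(** * Differentials of smooth functions *)

Section TwistorCalculus.
Variables (R : realType) (V : vectType R) (g : {dot V for idfun}).
Local Notation N := (\dim {:'End(V)}).
Implicit Types (K L : twistor g) (X Y Z C : 'End(V)) (f h : twistor g -> R).

Lemma smooth_at_germ f h K U : open U -> U (endo_coords K) ->
  (forall L, U (endo_coords L) -> f L = h L) -> smooth_at f K -> smooth_at h K.
Proof.
move=> oU UK fh [F [W [oW WK sF fF]]]; exists F, (U `&` W); split.
- exact: openI.
- by [].
- by move=> k; apply: Ck_subset (sF k) => x [].
- by move=> L [UL WL]; rewrite -fh // fF.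
Qed.

Lemma smooth_at_cst (c : R) K : smooth_at (fun=> c) K.
Proof.
exists (cst c), setT; split => //; first exact: openT.
by move=> k; exact: Ck_cst.
Qed.

Lemma smooth_at_add f h K : smooth_at f K -> smooth_at h K ->
  smooth_at (fun L => f L + h L) K.
Proof.
move=> [F [U [oU UK sF fF]]] [H [W [oW WK sH hH]]].
exists (fun x => F x + H x), (U `&` W); split => //; first exact: openI.
  move=> k; apply: Ck_add; first exact: openI.
    by apply: Ck_subset (sF k) => x [].
  by apply: Ck_subset (sH k) => x [].
by move=> L [UL WL]; rewrite fF // hH.
Qed.

Lemma smooth_at_mul f h K : smooth_at f K -> smooth_at h K ->
  smooth_at (fun L => f L * h L) K.
Proof.
move=> [F [U [oU UK sF fF]]] [H [W [oW WK sH hH]]].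
exists (fun x => F x * H x), (U `&` W); split => //; first exact: openI.
  move=> k; apply: Ck_mul; first exact: openI.
    by apply: Ck_subset (sF k) => x [].
  by apply: Ck_subset (sH k) => x [].
by move=> L [UL WL]; rewrite fF // hH.
Qed.

Lemma smooth_at_sum (I : Type) (r : seq I) (f : I -> twistor g -> R) K :
  (forall i, smooth_at (f i) K) -> smooth_at (fun L => \sum_(i <- r) f i L) K.
Proof.
move=> sf; elim: r => [|i r IH].
  by under eq_fun do rewrite big_nil; exact: smooth_at_cst.
by under eq_fun do rewrite big_cons; exact: smooth_at_add.
Qed.

Lemma smooth_at_restriction F U K : open U -> U (endo_coords K) ->
  smooth_on U F -> smooth_at (fun L => F (endo_coords L)) K.
Proof. by move=> oU UK sF; exists F, U. Qed.

Lemma smooth_at_coord i K : smooth_at (fun L => endo_coords L 0 i) K.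
Proof.
apply: (smooth_at_restriction (F := fun x => x 0 i) openT) => // k.
exact: Ck_coord.
Qed.

(** The chain rule along a Cayley curve. The left-hand function only involves f,
    so the derivative of F in a direction [C, K] depends on f alone. *)
Lemma local_extension_curve f K F C (sC : orthogonal_algebra g C) :
  local_extension f K F ->
  is_derive (0 : R) (1 : R) (fun t => f (cayley_curve sC K t))
    ('D_(endo_coords (commutator C K)) F (endo_coords K)).
Proof.
move=> [U [oU UK sF fF]].
pose c t := endo_coords (cayley_curve sC K t).
have c0 : c 0 = endo_coords K by rewrite /c cayley_curve0.
have dc : is_derive (0 : R) (1 : R) c (endo_coords (commutator C K)).
  exact: is_derive_cayley_curve.
have cc : {for (0 : R), continuous c}.
  by apply: differentiable_continuous; apply/derivable1_diffP; case: dc.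
have nU : \forall t \near (0 : R), U (c t).
  by apply: cc; rewrite c0; exact: (open_nbhs_nbhs (conj oU UK)).
have dF : differentiable F (c 0) by rewrite c0; have [H _] := sF 1%N; exact: H.
have := is_derive_curve dF dc; rewrite c0.
apply: near_eq_is_derive; apply: filterS nU => t Ut.
by rewrite /= -fF.
Qed.

(** K anticommutes with a tangent X, so X = [- X K / 2, K]. *)
Lemma tangent_commutator K X : tangent_space K X ->
  exists2 C, orthogonal_algebra g C & X = commutator C K.
Proof.
move=> [oX XK]; exists (- (1 / 2) *: (X \o K)%VF).
  have aX := (skewP g X).1 oX.
  have aXK := adjoint_comp aX (twistor_adjoint K).
  apply/skewP; rewrite -[X in is_adjoint _ _ X]scalerN; apply: adjointZ.
  suff -> : - (X \o K)%VF = ((- (K : 'End(V))) \o (- X))%VF by [].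
  by rewrite comp_lfunNl comp_lfunNr opprK; apply/esym/eqP; rewrite -addr_eq0 addrC XK eqxx.
have KX : (K \o X)%VF = - (X \o K)%VF.
  by apply/eqP; rewrite -addr_eq0 addrC XK eqxx.
rewrite /commutator ?endo_expand KX ?endo_expand -!comp_lfunA twistor_sqrE.
rewrite ?endo_expand; apply: endo_eqP => i; rewrite ?endo_scalarE; lra.
Qed.

Lemma commutator_tangent K C : orthogonal_algebra g C ->
  tangent_space K (commutator C K).
Proof.
move=> sC; split; first by apply: skew_commutator => //; exact: twistor_skew.
rewrite /commutator comp_lfunDl comp_lfunDr comp_lfunNl comp_lfunNr.
rewrite -!comp_lfunA !twistor_sqrE; rewrite !comp_lfunA twistor_sqrE.
endo_ring.
Qed.

Lemma local_extension_get f K : smooth_at f K ->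
  local_extension f K (get (local_extension f K)).
Proof. by move=> [F fF]; apply: getPex; exists F. Qed.

Lemma differential_curve f K C (sC : orthogonal_algebra g C) : smooth_at f K ->
  is_derive (0 : R) (1 : R) (fun t => f (cayley_curve sC K t))
    (differential f K (commutator C K)).
Proof.
by move=> sf; apply: local_extension_curve; exact: local_extension_get.
Qed.

Lemma differential_extension f K X F : local_extension f K F ->
  tangent_space K X -> differential f K X = 'D_(endo_coords X) F (endo_coords K).
Proof.
move=> fF /tangent_commutator[C sC ->].
have sf : smooth_at f K by exists F.
have [_ <-] := differential_curve sC sf.
by have [_ <-] := local_extension_curve sC fF.
Qed.

Lemma differential_germ f h K X U : open U -> U (endo_coords K) ->
  (forall L, U (endo_coords L) -> f L = h L) -> smooth_at f K ->
  tangent_space K X -> differential f K X = differential h K X.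
Proof.
move=> oU UK fh sf tX; have [F [W [oW WK sF fF]]] := sf.
have hF : local_extension h K F.
  exists (U `&` W); split => //; first exact: openI.
  - by move=> k; apply: Ck_subset (sF k) => x [].
  - by move=> L [UL WL]; rewrite -fh // fF.
have fF' : local_extension f K F by exists W.
by rewrite (differential_extension hF tX) (differential_extension fF' tX).
Qed.

Lemma differential_cst (c : R) K X : tangent_space K X ->
  differential (fun=> c) K X = 0.
Proof.
move=> /tangent_commutator[C sC ->].
have [_ <-] := differential_curve sC (smooth_at_cst c K).
exact: derive_cst.
Qed.

(** Applied to the coefficients a_i, which are constant along the Cayley curves
    of every C commuting with J. *)
Lemma differential_invariant f K C (sC : orthogonal_algebra g C) :
  smooth_at f K -> (forall t, f (cayley_curve sC K t) = f K) ->
  differential f K (commutator C K) = 0.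
Proof.
move=> sf fc; have [_ <-] := differential_curve sC sf.
by under eq_fun do rewrite fc; exact: derive_cst.
Qed.

Lemma differentialD f h K X : smooth_at f K -> smooth_at h K ->
  tangent_space K X ->
  differential (fun L => f L + h L) K X = differential f K X + differential h K X.
Proof.
move=> sf sh /tangent_commutator[C sC ->].
have [_ <-] := differential_curve sC (smooth_at_add sf sh).
have [df <-] := differential_curve sC sf.
have [dh <-] := differential_curve sC sh.
exact: deriveD.
Qed.

Lemma differentialM f h K X : smooth_at f K -> smooth_at h K ->
  tangent_space K X ->
  differential (fun L => f L * h L) K X =
  differential f K X * h K + f K * differential h K X.
Proof.
move=> sf sh /tangent_commutator[C sC ->].
have [_ <-] := differential_curve sC (smooth_at_mul sf sh).
have [df <-] := differential_curve sC sf.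
have [dh <-] := differential_curve sC sh.
rewrite (deriveM df dh) !cayley_curve0 /= addrC; congr (_ + _).
by rewrite mulrC.
Qed.

Lemma differential_sum (I : Type) (r : seq I) (f : I -> twistor g -> R) K X :
  (forall i, smooth_at (f i) K) -> tangent_space K X ->
  differential (fun L => \sum_(i <- r) f i L) K X =
  \sum_(i <- r) differential (f i) K X.
Proof.
move=> sf tX; elim: r => [|i r IH].
  by under eq_fun do rewrite big_nil; rewrite big_nil differential_cst.
under eq_fun do rewrite big_cons.
by rewrite big_cons differentialD ?IH //; exact: smooth_at_sum.
Qed.

Lemma tangent_linear K (c : R) X Y : tangent_space K X -> tangent_space K Y ->
  tangent_space K (c *: X + Y).
Proof.
move=> [oX XK] [oY YK]; split; first exact: skewD.
rewrite comp_lfunDl comp_lfunDr -comp_lfunZl -comp_lfunZr addrACA -scalerDr.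
by rewrite XK YK scaler0 addr0.
Qed.

Lemma differential_linear f K (c : R) X Y : smooth_at f K ->
  tangent_space K X -> tangent_space K Y ->
  differential f K (c *: X + Y) = c * differential f K X + differential f K Y.
Proof.
move=> [F fF] tX tY.
rewrite !(differential_extension fF) //; last exact: tangent_linear.
have [U [oU UK sF _]] := fF.
have dF : differentiable F (endo_coords K) by have [H _] := sF 1%N; exact: H.
by rewrite !deriveE // endo_coordsD endo_coordsZ linearP.
Qed.

End TwistorCalculus.

(** * Derivatives of endomorphism-valued maps and the Lie bracket *)

Section EndoCalculus.
Variables (R : realType) (V : vectType R) (g : {dot V for idfun}).
Local Notation N := (\dim {:'End(V)}).
Implicit Types (K L : twistor g) (X Y Z C : 'End(V)) (f h : twistor g -> R)
  (A B : twistor g -> 'End(V)).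

Lemma endo_scalar_expansion (c : 'I_N -> R) i :
  endo_scalar i (\sum_j c j *: endo_base j) = c i.
Proof.
rewrite /endo_scalar /endo_coords.
have -> : \sum_j c j *: endo_base j =
    passmx.vecof (vbasis {:'End(V)}) (\row_j c j).
  by apply: eq_bigr => j _; rewrite mxE.
by rewrite passmx.vecofK ?mxE //; exact: vbasisP.
Qed.

Lemma endo_smooth_at_cst C K : endo_smooth_at (fun=> C) K.
Proof. by move=> i; exact: smooth_at_cst. Qed.

Lemma endo_smooth_at_phi K : endo_smooth_at phi K.
Proof. by move=> i; exact: smooth_at_coord. Qed.

Lemma endo_smooth_atD A B K : endo_smooth_at A K -> endo_smooth_at B K ->
  endo_smooth_at (fun L => A L + B L) K.
Proof.
move=> sA sB i; have := smooth_at_add (sA i) (sB i).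
by congr smooth_at; apply/funext => L; rewrite endo_coordsD !mxE.
Qed.

Lemma endo_smooth_atZ f A K : smooth_at f K -> endo_smooth_at A K ->
  endo_smooth_at (fun L => f L *: A L) K.
Proof.
move=> sf sA i; have := smooth_at_mul sf (sA i).
by congr smooth_at; apply/funext => L; rewrite endo_coordsZ !mxE.
Qed.

Lemma endo_smooth_atN A K : endo_smooth_at A K ->
  endo_smooth_at (fun L => - A L) K.
Proof.
move=> sA; have := endo_smooth_atZ (smooth_at_cst (-1) K) sA.
by congr endo_smooth_at; apply/funext => L; rewrite scaleN1r.
Qed.

Lemma endo_smooth_at_sum (I : Type) (r : seq I) (A : I -> twistor g -> 'End(V)) K :
  (forall i, endo_smooth_at (A i) K) ->
  endo_smooth_at (fun L => \sum_(i <- r) A i L) K.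
Proof.
move=> sA; elim: r => [|i r IH].
  by under eq_fun do rewrite big_nil; exact: endo_smooth_at_cst.
by under eq_fun do rewrite big_cons; exact: endo_smooth_atD.
Qed.

Lemma endo_scalar_comp k (C D : 'End(V)) : endo_scalar k (C \o D)%VF =
  \sum_i \sum_j (endo_scalar i C * endo_scalar j D) *
    endo_scalar k (endo_base i \o endo_base j)%VF.
Proof.
rewrite comp_endo_sum /endo_scalar endo_coords_sum summxE.
apply: eq_bigr => i _; rewrite endo_coords_sum summxE.
by apply: eq_bigr => j _; rewrite endo_coordsZ mxE.
Qed.

Lemma endo_smooth_at_comp A B K : endo_smooth_at A K -> endo_smooth_at B K ->
  endo_smooth_at (fun L => (A L \o B L)%VF) K.
Proof.
move=> sA sB k.
have := @smooth_at_sum _ _ g _ (index_enum 'I_N) (fun i L =>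
  \sum_j (endo_scalar i (A L) * endo_scalar j (B L)) *
    endo_scalar k (endo_base i \o endo_base j)%VF) K.
under eq_fun do rewrite -endo_scalar_comp; apply => i.
apply: smooth_at_sum => j; apply: smooth_at_mul; last exact: smooth_at_cst.
by apply: smooth_at_mul; [exact: sA|exact: sB].
Qed.

Lemma endo_smooth_at_commutator A B K : endo_smooth_at A K -> endo_smooth_at B K ->
  endo_smooth_at (fun L => commutator (A L) (B L)) K.
Proof.
move=> sA sB; apply: endo_smooth_atD; first exact: endo_smooth_at_comp.
by apply: endo_smooth_atN; exact: endo_smooth_at_comp.
Qed.

(** The derivative d_X A at K, computed in the trivial bundle T x End V. *)
Definition endo_diff A K X : 'End(V) :=
  \sum_i differential (fun L => endo_scalar i (A L)) K X *: endo_base i.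

Lemma endo_scalar_diff i A K X :
  endo_scalar i (endo_diff A K X) = differential (fun L => endo_scalar i (A L)) K X.
Proof. exact: endo_scalar_expansion. Qed.

(* Keeps unification from unfolding the sum when it looks for an addition. *)
Opaque endo_diff.

Section Rules.
Variables (K : twistor g) (X : 'End(V)).
Hypothesis tX : tangent_space K X.

Lemma endo_diff_cst C : endo_diff (fun=> C) K X = 0.
Proof.
by apply: endo_eqP => i; rewrite endo_scalar_diff differential_cst // endo_scalar0.
Qed.

(** The coordinates of the Cayley curve are those of phi along it. *)
Lemma endo_diff_phi : endo_diff phi K X = X.
Proof.
apply: endo_eqP => i; rewrite endo_scalar_diff.
have [C sC ->] := tangent_commutator tX.
have [_ <-] := differential_curve sC (@endo_smooth_at_phi K i).
have [dc cE] := is_derive_cayley_curve sC K.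
by have := derive_mx dc; rewrite cE /endo_scalar => ->; rewrite mxE.
Qed.

Lemma endo_diffD A B : endo_smooth_at A K -> endo_smooth_at B K ->
  endo_diff (fun L => A L + B L) K X = endo_diff A K X + endo_diff B K X.
Proof.
move=> sA sB; apply: endo_eqP => i.
rewrite [RHS]endo_scalarD [LHS]endo_scalar_diff.
under eq_fun do rewrite endo_scalarD.
rewrite (differentialD (sA i) (sB i) tX).
by congr (_ + _); rewrite endo_scalar_diff.
Qed.

Lemma endo_diffZ f A : smooth_at f K -> endo_smooth_at A K ->
  endo_diff (fun L => f L *: A L) K X =
  differential f K X *: A K + f K *: endo_diff A K X.
Proof.
move=> sf sA; apply: endo_eqP => i.
rewrite [RHS]endo_scalarD [LHS]endo_scalar_diff.
under eq_fun do rewrite endo_scalarZ.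
rewrite (differentialM sf (sA i) tX).
by congr (_ + _); rewrite endo_scalarZ // endo_scalar_diff.
Qed.

Lemma endo_diffN A : endo_smooth_at A K ->
  endo_diff (fun L => - A L) K X = - endo_diff A K X.
Proof.
move=> sA; under eq_fun do rewrite -scaleN1r.
rewrite endo_diffZ //; last exact: smooth_at_cst.
by rewrite differential_cst // scale0r add0r scaleN1r.
Qed.

Lemma endo_diff_sum (I : Type) (r : seq I) (A : I -> twistor g -> 'End(V)) :
  (forall i, endo_smooth_at (A i) K) ->
  endo_diff (fun L => \sum_(i <- r) A i L) K X = \sum_(i <- r) endo_diff (A i) K X.
Proof.
move=> sA; elim: r => [|i r IH].
  by under eq_fun do rewrite big_nil; rewrite big_nil endo_diff_cst.
under eq_fun do rewrite big_cons.
by rewrite big_cons endo_diffD ?IH //; exact: endo_smooth_at_sum.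
Qed.

Lemma endo_diff_comp A B : endo_smooth_at A K -> endo_smooth_at B K ->
  endo_diff (fun L => (A L \o B L)%VF) K X =
  (endo_diff A K X \o B K)%VF + (A K \o endo_diff B K X)%VF.
Proof.
move=> sA sB; apply: endo_eqP => k; rewrite endo_scalarD endo_scalar_diff.
under eq_fun do rewrite endo_scalar_comp.
rewrite differential_sum //; last first.
  move=> i; apply: smooth_at_sum => j; apply: smooth_at_mul; last exact: smooth_at_cst.
  by apply: smooth_at_mul; [exact: sA|exact: sB].
rewrite !endo_scalar_comp -big_split; apply: eq_bigr => i _ /=.
rewrite differential_sum //; last first.
  move=> j; apply: smooth_at_mul; last exact: smooth_at_cst.
  by apply: smooth_at_mul; [exact: sA|exact: sB].
rewrite -big_split; apply: eq_bigr => j _ /=.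
rewrite differentialM //; last exact: smooth_at_cst; last first.
  by apply: smooth_at_mul; [exact: sA|exact: sB].
rewrite differential_cst // mulr0 addr0 differentialM //; last exact: sB; last exact: sA.
by rewrite !endo_scalar_diff mulrDl.
Qed.

Lemma endo_diff_functional (l : 'End(V) -> R) A :
  (forall c C D, l (c *: C + D) = c * l C + l D) -> endo_smooth_at A K ->
  l (endo_diff A K X) = differential (fun L => l (A L)) K X.
Proof.
move=> ll sA.
have l0 : l 0 = 0.
  by have := ll 1 0 0; rewrite scaler0 addr0 mul1r => H; lra.
have lsum (I : Type) (r : seq I) (c : I -> R) (e : I -> 'End(V)) :
    l (\sum_(i <- r) c i *: e i) = \sum_(i <- r) c i * l (e i).
  by elim: r => [|i r IH]; rewrite ?big_nil // !big_cons ll IH.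
rewrite [endo_diff _ _ _]endo_coordsK lsum.
have -> : (fun L => l (A L)) =
    (fun L => \sum_i endo_scalar i (A L) * l (endo_base i)).
  by apply/funext => L; rewrite {1}(endo_coordsK (A L)) lsum.
rewrite differential_sum //; last first.
  by move=> i; apply: smooth_at_mul; [exact: sA|exact: smooth_at_cst].
apply: eq_bigr => i _; rewrite -/(endo_scalar i _) endo_scalar_diff.
rewrite differentialM //; last exact: smooth_at_cst; last exact: sA.
by rewrite differential_cst // mulr0 addr0.
Qed.

(** The skew endomorphisms are cut out by the linear functionals
    A |-> g(A u, v) + g(u, A v), and d_X commutes with linear functionals. *)
Lemma endo_diff_skew A : (forall L, orthogonal_algebra g (A L)) ->
  endo_smooth_at A K -> orthogonal_algebra g (endo_diff A K X).
Proof.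
move=> oA sA u v.
rewrite (@endo_diff_functional (fun C => g (C u) v + g u (C v)) A) //.
  under eq_fun do rewrite oA.
  exact: differential_cst.
move=> c C D; rewrite !add_lfunE !scale_lfunE !metricE; ring.
Qed.

End Rules.

Lemma endo_diff_linear A K (c : R) X Y : endo_smooth_at A K ->
  tangent_space K X -> tangent_space K Y ->
  endo_diff A K (c *: X + Y) = c *: endo_diff A K X + endo_diff A K Y.
Proof.
move=> sA tX tY; apply: endo_eqP => i.
rewrite [RHS]endo_scalarD [LHS]endo_scalar_diff.
rewrite (differential_linear c (sA i) tX tY).
by congr (_ + _); rewrite ?endo_scalarZ endo_scalar_diff.
Qed.

Section LieDerivative.
Variables (f : twistor g -> R) (F : 'rV[R]_N -> R) (U : set 'rV[R]_N).
Hypotheses (oU : open U) (sF : smooth_on U F).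
Hypothesis fF : forall L, U (endo_coords L) -> f L = F (endo_coords L).

Let partial i L : R := 'D_(delta_mx 0 i) F (endo_coords L).

Lemma partial_smooth i K : U (endo_coords K) -> smooth_at (partial i) K.
Proof.
move=> UK; apply: (smooth_at_restriction (F := fun x => 'D_(delta_mx 0 i) F x) oU UK) => k.
by have [_ H] := sF k.+1; exact: H.
Qed.

Lemma derive_partials (H : 'rV[R]_N -> R) (x v : 'rV[R]_N) :
  differentiable H x -> 'D_v H x = \sum_i v 0 i * 'D_(delta_mx 0 i) H x.
Proof.
move=> dH; rewrite deriveE // {1}(row_sum_delta v) linear_sum.
by apply: eq_bigr => i _; rewrite linearZ /= deriveE.
Qed.

Lemma differential_partials L X : U (endo_coords L) -> tangent_space L X ->
  differential f L X = \sum_i endo_scalar i X * partial i L.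
Proof.
move=> UL tX.
have e : local_extension f L F by exists U.
rewrite (differential_extension e tX) derive_partials //.
by have [H _] := sF 1%N; exact: H.
Qed.

Variable X : twistor g -> 'End(V).
Hypotheses (tX : forall L, tangent_space L (X L)) (sX : endo_smooth X).

Lemma lie_derivative_smooth_at K : U (endo_coords K) ->
  smooth_at (lie_derivative X f) K.
Proof.
move=> UK; apply: (smooth_at_germ
  (f := fun L => \sum_i endo_scalar i (X L) * partial i L) oU UK).
  by move=> L UL; rewrite /lie_derivative differential_partials.
apply: smooth_at_sum => i; apply: smooth_at_mul; first exact: sX.
exact: partial_smooth.
Qed.

(** The second-order part is the second derivative of F in the directions X K
    and Y, hence symmetric in them. *)
Lemma lie_derivative2 K Y : U (endo_coords K) -> tangent_space K Y ->
  differential (lie_derivative X f) K Y =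
  \sum_i endo_scalar i (endo_diff X K Y) * partial i K +
  \sum_i \sum_j endo_scalar i (X K) * endo_scalar j Y *
    'D_(delta_mx 0 j) (fun x => 'D_(delta_mx 0 i) F x) (endo_coords K).
Proof.
move=> UK tY.
rewrite (@differential_germ _ _ _ _
  (fun L => \sum_i endo_scalar i (X L) * partial i L) _ _ _ oU UK) //; last 2 first.
- by move=> L UL; rewrite /lie_derivative differential_partials.
- exact: lie_derivative_smooth_at.
rewrite differential_sum //; last first.
  by move=> i; apply: smooth_at_mul; [exact: sX|exact: partial_smooth].
rewrite -big_split; apply: eq_bigr => i _ /=.
rewrite differentialM //; [|exact: sX|exact: partial_smooth].
rewrite endo_scalar_diff; congr (_ + _).
have e : local_extension (partial i) K (fun x => 'D_(delta_mx 0 i) F x).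
  by exists U; split => // k; have [_ H] := sF k.+1; exact: H.
rewrite (differential_extension e tY) derive_partials; last first.
  by have [_ H] := sF 2%N; have [H1 _] := H (delta_mx 0 i); exact: H1.
by rewrite mulr_sumr; apply: eq_bigr => j _; rewrite mulrA.
Qed.

End LieDerivative.

Lemma lie_derivative_smooth (X : twistor g -> 'End(V)) f :
  (forall L, tangent_space L (X L)) -> endo_smooth X -> smooth f ->
  smooth (lie_derivative X f).
Proof.
move=> tX sX sf K; have [F [U [oU UK sF fF]]] := sf K.
exact: (lie_derivative_smooth_at oU sF fF).
Qed.

(** In X(Y f) - Y(X f) the second-order parts cancel by [derive_comm]. *)
Lemma is_lie_bracketP (X Y Z : twistor g -> 'End(V)) :
  (forall L, tangent_space L (X L)) -> endo_smooth X ->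
  (forall L, tangent_space L (Y L)) -> endo_smooth Y ->
  (forall L, tangent_space L (Z L)) ->
  (forall K, Z K = endo_diff Y K (X K) - endo_diff X K (Y K)) ->
  is_lie_bracket X Y Z.
Proof.
move=> tX sX tY sY tZ ZE f sf K; have [F [U [oU UK sF fF]]] := sf K.
have mixed : \sum_i \sum_j endo_scalar i (Y K) * endo_scalar j (X K) *
      'D_(delta_mx 0 j) (fun x => 'D_(delta_mx 0 i) F x) (endo_coords K) =
    \sum_i \sum_j endo_scalar i (X K) * endo_scalar j (Y K) *
      'D_(delta_mx 0 j) (fun x => 'D_(delta_mx 0 i) F x) (endo_coords K).
  rewrite exchange_big; apply: eq_bigr => i _; apply: eq_bigr => j _ /=.
  rewrite (derive_comm _ _ oU UK (sF 2%N)).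
  by rewrite [endo_scalar j _ * _]mulrC.
rewrite -[W in _ = W - _]/(differential (lie_derivative Y f) K (X K)).
rewrite -[W in _ = _ - W]/(differential (lie_derivative X f) K (Y K)).
rewrite (lie_derivative2 oU sF fF tX sX UK (tY K)).
rewrite (lie_derivative2 oU sF fF tY sY UK (tX K)).
rewrite /lie_derivative (differential_partials oU sF fF UK (tZ K)) ZE.
rewrite mixed.
have cancel (x y z : R) : x + z - (y + z) = x - y by ring.
rewrite cancel -[RHS]sumrB; apply: eq_bigr => i _.
by rewrite -mulrBl endo_scalarD endo_scalarN.
Qed.

End EndoCalculus.

(** * The fibres of the twisted bundle *)

Section TwistedBundle.
Variables (R : realType) (V : vectType R) (g : {dot V for idfun}).
Implicit Types (K L : twistor g) (A B C D X Y : 'End(V)).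
Variable J : twistor g.

(** X divides D = [J, L] on both sides, up to nonzero scalars. Every value of S
    and every nonzero difference of two elements of {J, -J, phi, -phi} is of this
    form, for instance (J + phi) (phi - J) = [J, phi]; as D o D <> 0, no product
    of two of them can vanish. *)
Definition divides_commutator L X := exists T c c',
  [/\ c != 0, c' != 0, (X \o T)%VF = (c : R) *: commutator J L &
      (T \o X)%VF = (c' : R) *: commutator J L].

Lemma twistor_sqrl L A : (A \o L \o L)%VF = - A.
Proof. by rewrite -comp_lfunA twistor_sqrE comp_lfunNr comp_lfun1r. Qed.

Ltac twistor_ring := rewrite /commutator ?endo_expand ?twistor_sqrl ?twistor_sqrE
  ?endo_expand ?twistor_sqrl ?twistor_sqrE; endo_ring.

Lemma divides_J L : divides_commutator L J.
Proof.
exists (- (J \o commutator J L)%VF), 1, (-1); split;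
  rewrite ?oppr_eq0 ?oner_eq0 //; twistor_ring.
Qed.

Lemma divides_phi L : divides_commutator L L.
Proof.
exists (- (L \o commutator J L)%VF), 1, (-1); split;
  rewrite ?oppr_eq0 ?oner_eq0 //; twistor_ring.
Qed.

Lemma divides_add L : divides_commutator L ((J : 'End(V)) + (L : 'End(V))).
Proof.
exists ((L : 'End(V)) - (J : 'End(V))), 1, (-1); split;
  rewrite ?oppr_eq0 ?oner_eq0 //; twistor_ring.
Qed.

Lemma divides_sub L : divides_commutator L ((J : 'End(V)) - (L : 'End(V))).
Proof.
exists ((J : 'End(V)) + (L : 'End(V))), 1, (-1); split;
  rewrite ?oppr_eq0 ?oner_eq0 //; twistor_ring.
Qed.

Lemma divides_one L : divides_commutator L \1%VF.
Proof.
by exists (commutator J L), 1, 1; split; rewrite ?oner_eq0 //; twistor_ring.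
Qed.

Lemma divides_commutator_refl L : divides_commutator L (commutator J L).
Proof. by exists \1%VF, 1, 1; split; rewrite ?oner_eq0 //; twistor_ring. Qed.

(** D is skew, so g(D x, D x) = - g(x, D (D x)). *)
Lemma commutator_sqr_neq0 L : commutator J L <> 0 ->
  (commutator J L \o commutator J L)%VF <> 0.
Proof.
move=> D0 DD; apply: D0; apply/lfunP => x; rewrite zero_lfunE.
apply: (metric_eq0 (g := g)).
have /skewP := skew_commutator (twistor_skew J) (twistor_skew L).
by move=> ->; rewrite opp_lfunE -comp_lfunE DD zero_lfunE oppr0 metricE.
Qed.

Lemma divides_comp_neq0 L X Y : commutator J L <> 0 ->
  divides_commutator L X -> divides_commutator L Y -> (X \o Y)%VF <> 0.
Proof.
move=> /commutator_sqr_neq0 DD [T [c [c' [_ c'0 _ TX]]]] [T' [d [d' [d0 _ YT' _]]]] XY.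
have : (T \o (X \o Y) \o T')%VF = 0 by rewrite XY comp_lfun0r comp_lfun0l.
rewrite comp_lfunA TX -comp_lfunA YT' -comp_lfunZl -comp_lfunZr scalerA => /eqP.
rewrite scaler_eq0 mulf_eq0 (negPf c'0) (negPf d0) => /eqP; exact: DD.
Qed.

Lemma divides_S_section S L : S_sections J S -> divides_commutator L (S L).
Proof.
move=> [[[|]|]|] ->; [exact: divides_one|exact: divides_add|exact: divides_sub|].
exact: divides_commutator_refl.
Qed.

Lemma unit_section_difference g1 g2 L : unit_sections J g1 -> unit_sections J g2 ->
  g1 <> g2 -> exists2 c : R, c != 0 &
    exists2 X, divides_commutator L X & g1 L - g2 L = c *: X.
Proof.
have two : (2 : R) != 0 by rewrite pnatr_eq0.
have ntwo : (-2 : R) != 0 by rewrite oppr_eq0.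
have one : (1 : R) != 0 by exact: oner_neq0.
have none : (-1 : R) != 0 by rewrite oppr_eq0.
have dJ := divides_J L; have dL := divides_phi L.
have dp := divides_add L; have dm := divides_sub L.
have tac (X Y : 'End(V)) (c : R) : c != 0 -> divides_commutator L X ->
  Y = c *: X -> exists2 c : R, c != 0 & exists2 X, divides_commutator L X & Y = c *: X.
  by move=> c0 dX ->; exists c => //; exists X.
move=> [[[|]|]|] -> [[[|]|]|] -> //= _; rewrite /const_section /phi.
- by apply: (tac J _ 2) => //; endo_ring.
- by apply: (tac _ _ 1 _ dm) => //; endo_ring.
- by apply: (tac _ _ 1 _ dp) => //; endo_ring.
- by apply: (tac J _ (-2)) => //; endo_ring.
- by apply: (tac _ _ (-1) _ dp) => //; endo_ring.
- by apply: (tac _ _ (-1) _ dm) => //; endo_ring.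
- by apply: (tac _ _ (-1) _ dm) => //; endo_ring.
- by apply: (tac _ _ 1 _ dp) => //; endo_ring.
- by apply: (tac L _ 2) => //; endo_ring.
- by apply: (tac _ _ (-1) _ dp) => //; endo_ring.
- by apply: (tac _ _ 1 _ dm) => //; endo_ring.
- by apply: (tac L _ (-2)) => //; endo_ring.
Qed.

Hypothesis dimV : (2 < \dim {:V})%N.

(** If S g1 = S g2 with g1 <> g2, then at an L not commuting with J the product
    of the two divisors S and g1 - g2 of [J, L] would vanish. *)
Lemma unit_section_unique_r S g1 g2 : S_sections J S ->
  unit_sections J g1 -> unit_sections J g2 ->
  (forall L, (S L \o g1 L)%VF = (S L \o g2 L)%VF) -> g1 = g2.
Proof.
move=> HS H1 H2 S12; apply: contrapT => g12.
have [L JL] := exists_noncommuting_twistor J dimV.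
have JL0 : commutator J L <> 0 by move=> /subr0_eq.
have [c c0 [X dX E]] := unit_section_difference L H1 H2 g12.
apply: (divides_comp_neq0 JL0 (divides_S_section L HS) dX).
apply/eqP; have : (S L \o (c *: X))%VF == 0.
  by rewrite -E comp_lfunDr comp_lfunNr S12 subrr.
by rewrite -comp_lfunZr scaler_eq0 (negPf c0).
Qed.

Lemma unit_section_unique_l S g1 g2 : S_sections J S ->
  unit_sections J g1 -> unit_sections J g2 ->
  (forall L, (g1 L \o S L)%VF = (g2 L \o S L)%VF) -> g1 = g2.
Proof.
move=> HS H1 H2 S12; apply: contrapT => g12.
have [L JL] := exists_noncommuting_twistor J dimV.
have JL0 : commutator J L <> 0 by move=> /subr0_eq.
have [c c0 [X dX E]] := unit_section_difference L H1 H2 g12.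
apply: (divides_comp_neq0 JL0 dX (divides_S_section L HS)).
apply/eqP; have : ((c *: X) \o S L)%VF == 0.
  by rewrite -E comp_lfunDl comp_lfunNl S12 subrr.
by rewrite -comp_lfunZl scaler_eq0 (negPf c0).
Qed.

(** The pairs (gamma, e) are (J, 1), (phi, 1), (phi, -1) and (J, -1); both
    elements gamma' and delta' that define the twisted bundle equal e gamma. *)
Lemma S_section_intertwines S : S_sections J S ->
  exists gamma, (gamma = const_section (J : 'End(V)) \/ gamma = phi) /\
  exists2 e : R, e = 1 \/ e = -1 &
    [/\ unit_sections J (fun L => e *: gamma L),
      forall L, (J \o S L)%VF = e *: (S L \o gamma L)%VF &
      forall L, (S L \o J)%VF = e *: (gamma L \o S L)%VF].
Proof.
move=> [[[|]|]|] ->.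
- exists (const_section (J : 'End(V))); split; first by left.
  exists 1; first by left.
  split=> [|L|L]; rewrite /const_section ?scale1r; first by left; left; left.
    by twistor_ring.
  by twistor_ring.
- exists phi; split; first by right.
  exists 1; first by left.
  split=> [|L|L]; rewrite /phi ?scale1r; last 2 first.
  + by twistor_ring.
  + by twistor_ring.
  by left; right; apply/funext => L; rewrite scale1r.
- exists phi; split; first by right.
  exists (-1); first by right.
  split=> [|L|L]; rewrite /phi ?scaleN1r; last 2 first.
  + by twistor_ring.
  + by twistor_ring.
  by right; apply/funext => L; rewrite scaleN1r.
- exists (const_section (J : 'End(V))); split; first by left.
  exists (-1); first by right.
  split=> [|L|L]; rewrite /const_section ?scaleN1r; last 2 first.
  + by twistor_ring.
  + by twistor_ring.
  by left; left; right; apply/funext => L.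
Qed.

Lemma twisted_unitaryP S gamma (e : R) : S_sections J S -> e = 1 \/ e = -1 ->
  unit_sections J (fun L => e *: gamma L) ->
  (forall L, (J \o S L)%VF = e *: (S L \o gamma L)%VF) ->
  (forall L, (S L \o J)%VF = e *: (gamma L \o S L)%VF) ->
  forall K B, twisted_unitary_bundle J S K B <-> commuting_skew g (gamma K) B.
Proof.
move=> HS e1 He JS SJ K B.
have e0 : e != 0 by case: e1 => ->; rewrite ?oppr_eq0 oner_eq0.
have inter : intertwining_bundle (fun L => e *: gamma L) (fun L => e *: gamma L) K B <->
    commuting_skew g (gamma K) B.
  split=> -[sB BE]; split => //.
    move: BE; rewrite -comp_lfunZl -comp_lfunZr => /(congr1 (fun X => e^-1 *: X)).
    by rewrite !scalerA mulVf // !scale1r.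
  by rewrite -comp_lfunZl -comp_lfunZr BE.
split=> [[g1 [g2 [[H1 H2] E1 E2 HB]]]|HB].
  have G1 : g1 = (fun L => e *: gamma L).
    apply: (unit_section_unique_r HS H1 He) => L.
    by rewrite -E1 -comp_lfunZr; exact: JS.
  have G2 : g2 = (fun L => e *: gamma L).
    apply: (unit_section_unique_l HS H2 He) => L.
    by rewrite -E2 -comp_lfunZl; exact: SJ.
  by move: HB; rewrite G1 G2 => /inter.
exists (fun L => e *: gamma L), (fun L => e *: gamma L); split => //.
- by move=> L; rewrite -comp_lfunZr -JS.
- by move=> L; rewrite -comp_lfunZl -SJ.
- exact/inter.
Qed.

End TwistedBundle.

(** * Local frames *)

Section Frames.
Variables (R : realType) (V : vectType R) (g : {dot V for idfun}).
Implicit Types (K L : twistor g) (A B C D X Y : 'End(V)).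

(** Let P be the projector on the kernel of K + L. Then (K - L) P = 2 K P, that
    is P = - K (K - L) P / 2, and for L close to K this gives |P| <= |P| / 2. *)
Lemma near_invertible K : exists2 d : R, 0 < d & forall L,
  endo_norm (twistor_endo K - twistor_endo L) < d ->
  lker (twistor_endo K + twistor_endo L) == 0%VS.
Proof.
have [m m0 mP] := endo_norm_comp V.
pose q := m * endo_norm K * m.
have q0 : 0 <= q by rewrite !mulr_ge0 ?normr_ge0 // ltW.
exists (q + 1)^-1; first by rewrite invr_gt0 ltr_wpDl.
move=> L; set D := twistor_endo K - twistor_endo L => Dd.
set P := projv (lker (twistor_endo K + twistor_endo L)).
have KLP : ((twistor_endo K + twistor_endo L) \o P)%VF = 0.
  apply/lfunP => x; rewrite comp_lfunE zero_lfunE; apply/eqP.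
  by rewrite -memv_ker memv_proj.
have PE : P = - (1 / 2) *: (K \o (D \o P))%VF.
  have -> : (D \o P)%VF = 2 *: (K \o P)%VF.
    apply/eqP; rewrite -subr_eq0 -oppr_eq0 -KLP; apply/eqP.
    rewrite /D ?endo_expand; apply: endo_eqP => i; rewrite ?endo_scalarE; ring.
  rewrite -comp_lfunZr comp_lfunA twistor_sqrE.
  rewrite ?endo_expand; apply: endo_eqP => i; rewrite ?endo_scalarE; lra.
have P0 : endo_norm P <= 0.
  have n0 := normr_ge0 (endo_coords P); rewrite -/(endo_norm P) in n0.
  have D0 := normr_ge0 (endo_coords D); rewrite -/(endo_norm D) in D0.
  have : endo_norm P <= q * endo_norm D * endo_norm P / 2.
    rewrite {1}PE endo_normZ normrN ger0_norm //.
    have := mP K (D \o P)%VF; have := mP D P.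
    have k0 : 0 <= m * endo_norm K by rewrite mulr_ge0 ?normr_ge0 // ltW.
    move=> /(ler_wpM2l k0); rewrite /q; set z := endo_norm (D \o P)%VF; lra.
  have qD : q * endo_norm D <= 1.
    apply: (@le_trans _ _ (q * (q + 1)^-1)); first by rewrite ler_wpM2l // ltW.
    by rewrite ler_pdivrMr ?ltr_wpDl // mul1r lerDl.
  have := ler_wpM2r n0 qD; rewrite mul1r; lra.
have P00 := endo_norm_eq0 P0.
rewrite -subv0; apply/subvP => w wW.
by rewrite -(projv_id wW) -/P P00 zero_lfunE mem0v.
Qed.

(** L (K + L) and (K + L) K are both L K - 1. *)
Lemma twistor_sum_sandwich K L A : commuting_skew g K A ->
  commuting_skew g L (sandwich (twistor_endo K + twistor_endo L)
    (- (twistor_endo K + twistor_endo L)) A).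
Proof.
move=> HA; rewrite sandwichE; apply: (commuting_skew_sandwich (K := K)) => //.
- have -> : - (twistor_endo K + twistor_endo L) = - (K : 'End(V)) + - (L : 'End(V)).
    by rewrite opprD.
  by apply: adjointD; exact: twistor_adjoint.
- by rewrite ?endo_expand !twistor_sqrE addrC.
- by rewrite ?endo_expand !twistor_sqrE addrC.
Qed.

(** A constant frame for gamma = J. For gamma = phi, the image of a basis of the
    fibre at K under B |-> (K + L) B (K + L), up to sign, is free as K + L is
    invertible, and it spans the fibre at L because the dimensions agree. *)
Lemma commuting_skew_subbundle (J : twistor g) (gamma : twistor g -> 'End(V))
    (E : twistor g -> set 'End(V)) :
  gamma = const_section (J : 'End(V)) \/ gamma = phi ->
  (forall K B, E K B <-> commuting_skew g (gamma K) B) ->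
  exists r, is_subbundle E r.
Proof.
move=> Hg HE.
have [UJ HUJ] := commuting_skew_vspace g J.
exists (\dim UJ) => K; case: Hg => gE; subst gamma.
  exists setT, (fun i _ => (vbasis UJ)`_i); split => //; first exact: openT.
  move=> L _.
  have bE : [tuple (vbasis UJ)`_i | i < \dim UJ] = vbasis UJ :> seq _.
    by rewrite -[RHS]map_tnth_enum; apply: eq_map => i; rewrite (tnth_nth 0).
  split; first by move=> i; exact: endo_smooth_at_cst.
    by rewrite bE; exact: basis_free (vbasisP UJ).
  move=> B; rewrite bE (span_basis (vbasisP UJ)).
  by split => [/HE/HUJ|/HUJ/HE].
have [d d0 dP] := near_invertible K.
have [UK HUK] := commuting_skew_vspace g K.
have dimE := commuting_skew_dim HUJ HUK.
pose T (L : twistor g) := sandwich (twistor_endo K + twistor_endo L)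
  (- (twistor_endo K + twistor_endo L)).
exists (ball (endo_coords K) d), (fun i L => T L (vbasis UK)`_i); split.
- exact: ball_open.
- exact: ballxx.
move=> L; rewrite -ball_normE /ball_ /= -endo_coordsN -endo_coordsD => /dP inj.
have injN : lker (- (twistor_endo K + twistor_endo L)) == 0%VS.
  by apply/lker0P => x y; rewrite !opp_lfunE => /oppr_inj; apply/lker0P.
have injT := sandwich_inj inj injN.
have bE : [tuple T L (vbasis UK)`_i | i < \dim UJ] = map (T L) (vbasis UK) :> seq _.
  apply: (@eq_from_nth _ 0) => [|i]; first by rewrite size_tuple size_map size_tuple dimE.
  rewrite size_tuple => hi; rewrite -[i]/(nat_of_ord (Ordinal hi)) -tnth_nth.
  by rewrite tnth_mktuple (nth_map 0) // size_tuple -dimE.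
have basis : basis_of (T L @: UK)%VS (map (T L) (vbasis UK)).
  by apply: limg_basis_of (vbasisP UK); rewrite (eqP injT) capv0.
split.
- move=> i; rewrite /T.
  under eq_fun do rewrite sandwichE.
  apply: endo_smooth_at_comp; last first.
    apply: endo_smooth_atN; apply: endo_smooth_atD; first exact: endo_smooth_at_cst.
    exact: endo_smooth_at_phi.
  apply: endo_smooth_at_comp; last exact: endo_smooth_at_cst.
  apply: endo_smooth_atD; first exact: endo_smooth_at_cst.
  exact: endo_smooth_at_phi.
- by rewrite bE; exact: basis_free basis.
move=> B; rewrite bE (span_basis basis).
have [UL HUL] := commuting_skew_vspace g L.
suff -> : (T L @: UK)%VS = UL by split => [/HE/HUL|/HUL/HE].
apply/eqP; rewrite eqEdim; apply/andP; split.
  apply/subvP => _ /memv_imgP[A AU ->]; apply/HUL; apply: twistor_sum_sandwich.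
  exact/HUK.
rewrite limg_dim_eq; last by rewrite (eqP injT) capv0.
by rewrite (commuting_skew_dim HUK HUL).
Qed.

End Frames.

(** * The bracket of an anchored bundle *)

Section NoncommutativeIdentities.
Variables (R : realType) (V : vectType R).
Implicit Types A B C D F K M : 'End(V).

(** When d F = [C, F] and d B = D, the left-hand side is d (F B F). *)
Lemma sandwich_derivation C F B D :
  (commutator C F \o B \o F)%VF + (F \o D \o F)%VF + (F \o B \o commutator C F)%VF =
  (F \o (D - commutator C B) \o F)%VF + commutator C (F \o B \o F)%VF.
Proof. endo_ring. Qed.

(** With X = [C, K], Y = [D, K], M = d_X D and M' = d_Y C, the left-hand side is
    d_X Y - d_Y X; the double commutators combine by the Jacobi identity. *)
Lemma commutator_cocycle C D K M M' :
  commutator M K + commutator D (commutator C K) -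
    (commutator M' K + commutator C (commutator D K)) =
  commutator (M - M' - commutator C D) K.
Proof. endo_ring. Qed.

End NoncommutativeIdentities.

Section Bracket.
Variables (R : realType) (V : vectType R) (g : {dot V for idfun}).
Implicit Types (K L : twistor g) (C D X Y : 'End(V)) (A B : twistor g -> 'End(V)).
Variables (J : twistor g) (E : twistor g -> set 'End(V)).
Variables (F gamma : twistor g -> 'End(V)) (e sigma : R).

Hypothesis EE : forall K C, E K C <-> commuting_skew g (gamma K) C.
Hypothesis E_subbundle : exists r, is_subbundle E r.
Hypothesis F_smooth : endo_smooth F.
Hypothesis gamma_smooth : endo_smooth gamma.
Hypotheses (e_sqr : e * e = 1) (sigma_sqr : sigma * sigma = 1).
Hypothesis F_adjoint : forall K, is_adjoint g (F K) (sigma *: F K).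
Hypothesis JF : forall K, (J \o F K)%VF = e *: (F K \o gamma K)%VF.
Hypothesis FJ : forall K, (F K \o J)%VF = e *: (gamma K \o F K)%VF.

(** T is parallel for the derivation d - [C, .] in every direction [C, K] with C
    skew and commuting with J. *)
Definition flat (T : twistor g -> 'End(V)) := forall K C,
  orthogonal_algebra g C -> (C \o J)%VF = (J \o C)%VF ->
  endo_diff T K (commutator C K) = commutator C (T K).

Hypothesis F_flat : flat F.
Hypothesis gamma_flat : flat gamma.

Let conj A K : 'End(V) := (F K \o A K \o F K)%VF.
Let psi K C : 'End(V) := commutator (F K \o C \o F K)%VF (phi K).
Let X A K : 'End(V) := psi K (A K).

Definition anchored_bracket A B K : 'End(V) :=
  endo_diff B K (X A K) - endo_diff A K (X B K)
  - commutator (conj A K) (B K) + commutator (conj B K) (A K)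
  + ((A K \o F K \o F K \o B K)%VF - (B K \o F K \o F K \o A K)%VF).

Let E_skew K C : E K C -> orthogonal_algebra g C.
Proof. by move=> /EE []. Qed.

Let conj_skew K C : orthogonal_algebra g C ->
  orthogonal_algebra g (F K \o C \o F K)%VF.
Proof.
move=> sC.
have := skewD sigma (skew_sandwich (F_adjoint K) sC) (skew0 g).
by rewrite addr0 -comp_lfunZr scalerA sigma_sqr scale1r.
Qed.

Let Fgamma K : (F K \o gamma K)%VF = e *: (J \o F K)%VF.
Proof. by rewrite JF scalerA e_sqr scale1r. Qed.

(** F exchanges J and gamma up to the sign e, and e * e = 1. *)
Let conj_J K C : E K C -> ((F K \o C \o F K) \o J)%VF = (J \o (F K \o C \o F K))%VF.
Proof.
move=> /EE[_ CG].
rewrite -comp_lfunA FJ -comp_lfunZr (comp_lfunA _ (gamma K)) -(comp_lfunA (F K) C) CG.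
by rewrite !comp_lfunA Fgamma -!comp_lfunZl scalerA e_sqr scale1r.
Qed.

Let sqrF_gamma K : (F K \o F K \o gamma K)%VF = (gamma K \o F K \o F K)%VF.
Proof.
rewrite -comp_lfunA Fgamma -comp_lfunZr (comp_lfunA (F K) J) FJ -comp_lfunZl scalerA.
by rewrite e_sqr scale1r.
Qed.

Let X_tangent A K : E K (A K) -> tangent_space K (X A K).
Proof. by move=> EA; apply: commutator_tangent; apply: conj_skew; exact: E_skew EA. Qed.

Let conj_smooth A : endo_smooth A -> endo_smooth (conj A).
Proof.
move=> sA K; apply: endo_smooth_at_comp; last exact: F_smooth.
by apply: endo_smooth_at_comp; [exact: F_smooth|exact: sA].
Qed.

Let X_smooth A : endo_smooth A -> endo_smooth (X A).
Proof.
move=> sA K; apply: endo_smooth_at_commutator; first exact: conj_smooth.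
exact: endo_smooth_at_phi.
Qed.

Lemma endo_diff_smooth A (W : twistor g -> 'End(V)) :
  endo_smooth A -> endo_smooth W -> (forall K, tangent_space K (W K)) ->
  endo_smooth (fun K => endo_diff A K (W K)).
Proof.
move=> sA sW tW K i.
have := lie_derivative_smooth tW sW (f := fun L => endo_scalar i (A L)) (fun L => sA L i) K.
by congr smooth_at; apply/funext => L; rewrite -[RHS]/(endo_scalar i _) endo_scalar_diff.
Qed.

Let bracket_smooth A B : is_section E A -> is_section E B ->
  endo_smooth (anchored_bracket A B).
Proof.
move=> [sA EA] [sB EB] K.
have tA L := X_tangent (EA L); have tB L := X_tangent (EB L).
have sF := F_smooth K.
have dAB := endo_diff_smooth sA (X_smooth sB) tB K.
have dBA := endo_diff_smooth sB (X_smooth sA) tA K.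
have cA := conj_smooth sA K; have cB := conj_smooth sB K.
apply: endo_smooth_atD.
  apply: endo_smooth_atD; last by apply: endo_smooth_at_commutator => //; exact: sA.
  apply: endo_smooth_atD.
    by apply: endo_smooth_atD => //; exact: endo_smooth_atN.
  by apply: endo_smooth_atN; apply: endo_smooth_at_commutator => //; exact: sB.
have word A' B' : endo_smooth A' -> endo_smooth B' ->
   endo_smooth_at (fun L => (A' L \o F L \o F L \o B' L)%VF) K.
  move=> sA' sB'; apply: endo_smooth_at_comp; last exact: sB'.
  apply: endo_smooth_at_comp; last exact: sF.
  by apply: endo_smooth_at_comp; [exact: sA'|exact: sF].
by apply: endo_smooth_atD; [|apply: endo_smooth_atN]; exact: word.
Qed.

Let bracket_skew_algebra A B K : is_section E A -> is_section E B ->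
  orthogonal_algebra g (anchored_bracket A B K).
Proof.
move=> [sA EA] [sB EB].
have oA L := E_skew (EA L); have oB L := E_skew (EB L).
have cA := conj_skew K (oA K); have cB := conj_skew K (oB K).
apply: skew_add; last first.
  apply/skewP.
  have aA := (skewP g _).1 (oA K); have aB := (skewP g _).1 (oB K).
  have aF := F_adjoint K.
  have word C D : is_adjoint g C (- C) -> is_adjoint g D (- D) ->
      is_adjoint g (C \o F K \o F K \o D)%VF (D \o F K \o F K \o C)%VF.
    move=> aC aD.
    have := adjoint_comp (adjoint_comp (adjoint_comp aC aF) aF) aD.
    congr is_adjoint; rewrite !endo_expand scalerA sigma_sqr scale1r !opprK.
    by [].
  by rewrite opprB; apply: adjointD; [|apply: adjointN]; exact: word.
apply: skew_add; last exact: skew_commutator.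
apply: skew_add; last by apply: skewN; exact: skew_commutator.
apply: skew_add; first by apply: endo_diff_skew => //; exact: X_tangent.
by apply: skewN; apply: endo_diff_skew => //; exact: X_tangent.
Qed.

(** Differentiate B gamma = gamma B and use d gamma = [C, gamma]: the derivation
    d - [C, .] preserves the commutant of a parallel section. *)
Let covariant_comm B K C : is_section E B -> orthogonal_algebra g C ->
  (C \o J)%VF = (J \o C)%VF ->
  commutator (endo_diff B K (commutator C K) - commutator C (B K)) (gamma K) = 0.
Proof.
move=> [sB EB] sC CJ.
have tC := commutator_tangent K sC.
have Bg L : (B L \o gamma L)%VF = (gamma L \o B L)%VF by have /EE[] := EB L.
have : endo_diff (fun L => (B L \o gamma L)%VF) K (commutator C K) =
       endo_diff (fun L => (gamma L \o B L)%VF) K (commutator C K).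
  by rewrite (_ : (fun L => _) = (fun L => (gamma L \o B L)%VF)) //; exact: funext Bg.
rewrite (endo_diff_comp tC (sB K) (gamma_smooth K)).
rewrite (endo_diff_comp tC (gamma_smooth K) (sB K)) (gamma_flat K sC CJ) => H.
set dB := endo_diff B K _ in H *.
have H2 : (dB \o gamma K)%VF = (commutator C (gamma K) \o B K)%VF
    + (gamma K \o dB)%VF - (B K \o commutator C (gamma K))%VF.
  by rewrite -H addrK.
transitivity ((dB \o gamma K)%VF - (gamma K \o dB)%VF -
   commutator (commutator C (B K)) (gamma K)); first by endo_ring.
rewrite H2.
transitivity ((C \o ((gamma K \o B K) - (B K \o gamma K)))%VF +
   (((B K \o gamma K) - (gamma K \o B K)) \o C)%VF); first by endo_ring.
by rewrite Bg subrr comp_lfun0l comp_lfun0r addr0.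
Qed.

(** The words A F^2 B commute with gamma because F^2 does. *)
Let bracket_comm A B K : is_section E A -> is_section E B ->
  (anchored_bracket A B K \o gamma K)%VF = (gamma K \o anchored_bracket A B K)%VF.
Proof.
move=> hA hB; have [sA EA] := hA; have [sB EB] := hB.
have cA := conj_skew K (E_skew (EA K)); have cB := conj_skew K (E_skew (EB K)).
have H1 := covariant_comm K hB cA (conj_J (EA K)).
have H2 := covariant_comm K hA cB (conj_J (EB K)).
have word A' B' : is_section E A' -> is_section E B' ->
  commutator (A' K \o F K \o F K \o B' K)%VF (gamma K) = 0.
  move=> [_ EA'] [_ EB']; have /EE[_ Ag] := EA' K; have /EE[_ Bg] := EB' K.
  rewrite /commutator -(comp_lfunA _ (B' K)) Bg !comp_lfunA.
  rewrite -(comp_lfunA _ _ (gamma K)) -(comp_lfunA (A' K)).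
  by rewrite (comp_lfunA (F K) (F K)) sqrF_gamma !comp_lfunA Ag subrr.
apply: subr0_eq; rewrite -/(commutator _ _).
transitivity (commutator (endo_diff B K (X A K) - commutator (conj A K) (B K)) (gamma K)
  - commutator (endo_diff A K (X B K) - commutator (conj B K) (A K)) (gamma K)
  + (commutator (A K \o F K \o F K \o B K)%VF (gamma K)
  - commutator (B K \o F K \o F K \o A K)%VF (gamma K))).
  rewrite /anchored_bracket; move: (endo_diff B K _) (endo_diff A K _) => dB dA.
  by move: (conj A K) (conj B K) (A K) (B K) (F K) (gamma K) => *; endo_ring.
by rewrite (word _ _ hA hB) (word _ _ hB hA) H1 H2 !subr0 addr0.
Qed.

(** By [sandwich_derivation], d_X (F B F) = F (d_X B - [C, B]) F + [C, D], and
    [C, D] = F (A F^2 B - B F^2 A) F, so F [A, B]_F F = d_X D - d_Y C - [C, D];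
    conclude by [commutator_cocycle]. *)
Let X_bracket A B K : is_section E A -> is_section E B ->
  X (anchored_bracket A B) K =
  endo_diff (X B) K (X A K) - endo_diff (X A) K (X B K).
Proof.
move=> hA hB; have [sA EA] := hA; have [sB EB] := hB.
have dX A' B' : is_section E A' -> is_section E B' ->
  endo_diff (X B') K (X A' K) =
  commutator ((commutator (conj A' K) (F K) \o B' K \o F K)%VF +
    (F K \o endo_diff B' K (X A' K) \o F K)%VF +
    (F K \o B' K \o commutator (conj A' K) (F K))%VF) (phi K) +
  commutator (conj B' K) (X A' K).
  move=> [sA' EA'] [sB' EB'].
  have tA := X_tangent (EA' K).
  have dF : endo_diff F K (X A' K) = commutator (conj A' K) (F K).
    by apply: F_flat; [apply: conj_skew; exact: E_skew (EA' K)|exact: conj_J].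
  have sFK := F_smooth K; have sBK := sB' K.
  have sFB := endo_smooth_at_comp sFK sBK.
  have sC := endo_smooth_at_comp sFB sFK.
  have sphi := @endo_smooth_at_phi _ _ g K.
  have sCK := endo_smooth_at_comp sC sphi; have sKC := endo_smooth_at_comp sphi sC.
  rewrite {1}/X /psi /commutator.
  rewrite (endo_diffD tA sCK (endo_smooth_atN sKC)) (endo_diffN tA sKC).
  rewrite (endo_diff_comp tA sC sphi) (endo_diff_comp tA sphi sC).
  rewrite (endo_diff_comp tA sFB sFK) (endo_diff_comp tA sFK sBK).
  rewrite (endo_diff_phi tA) dF.
  rewrite /conj; move: (endo_diff B' K _) => dB'.
  by move: (X A' K) (A' K) (B' K) (F K) => *; endo_ring.
rewrite !dX //.
rewrite {1}/X {1}/psi /anchored_bracket /phi.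
move: (endo_diff A K _) (endo_diff B K _) => dA dB.
rewrite !sandwich_derivation.
have XE A' : X A' K = commutator (conj A' K) K by [].
rewrite !XE commutator_cocycle; congr (commutator _ _).
pose N := ((A K \o F K \o F K \o B K) - (B K \o F K \o F K \o A K))%VF.
have AB : commutator (conj A K) (conj B K) = (F K \o N \o F K)%VF.
  by rewrite /N /conj; move: (A K) (B K) (F K) => *; endo_ring.
have BA : commutator (conj B K) (conj A K) = - (F K \o N \o F K)%VF.
  by rewrite -AB /commutator opprB.
rewrite -/(conj A K) -/(conj B K) AB BA -/N.
clear AB BA; clearbody N.
move: (commutator _ (A K)) (commutator _ (B K)) (F K) => *; endo_ring.
Qed.

Let psi_linear K (c : R) C D : psi K (c *: C + D) = c *: psi K C + psi K D.
Proof. by rewrite /psi; endo_ring. Qed.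

Lemma anchored_bracket_skew_algebroid :
  skew_algebroid E (fun K C => commutator (F K \o C \o F K)%VF (phi K))
    anchored_bracket.
Proof.
rewrite -/psi.
have XE A : on_sections psi A = X A by [].
split.
- exact: E_subbundle.
- split.
  + move=> K C EC; apply: commutator_tangent; apply: conj_skew; exact: E_skew EC.
  + by move=> K c C D _ _; exact: psi_linear.
  + by move=> A [sA _]; exact: X_smooth.
- move=> A B hA hB; split; first exact: bracket_smooth.
  by move=> K; apply/EE; split; [exact: bracket_skew_algebra|exact: bracket_comm].
- by move=> A B _ _ K; rewrite /anchored_bracket; endo_ring.
- move=> c A B C hA [sB EB] [sC EC] K; have [sA EA] := hA.
  have tA := X_tangent (EA K); have tB := X_tangent (EB K).
  have tC := X_tangent (EC K).
  have XL : X (fun L => c *: B L + C L) K = c *: X B K + X C K by exact: psi_linear.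
  rewrite /anchored_bracket XL endo_diff_linear //.
  rewrite endo_diffD //; last by apply: endo_smooth_atZ => //; exact: smooth_at_cst.
  rewrite endo_diffZ //; last exact: smooth_at_cst.
  rewrite differential_cst // scale0r add0r.
  have -> : conj (fun L => c *: B L + C L) K = c *: conj B K + conj C K.
    by rewrite /conj; move: (B K) (C K) (F K) => *; endo_ring.
  move: (endo_diff A K _) (endo_diff A K _) => dA dA'.
  move: (endo_diff B K _) (endo_diff C K _) => dB dC.
  move: (conj A K) (conj B K) (conj C K) (A K) (B K) (C K) (F K) => *.
  by endo_ring.
- move=> A B hA hB; have [sA EA] := hA; have [sB EB] := hB.
  rewrite !XE; apply: is_lie_bracketP.
  + by move=> L; exact: X_tangent.
  + exact: X_smooth.
  + by move=> L; exact: X_tangent.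
  + exact: X_smooth.
  + move=> L; apply: commutator_tangent; apply: conj_skew.
    exact: bracket_skew_algebra.
  + by move=> K; exact: X_bracket.
- move=> A B f hA [sB EB] sf K; have [sA EA] := hA.
  have tA := X_tangent (EA K); have tB := X_tangent (EB K).
  have XL : X (fun L => f L *: B L) K = f K *: X B K + 0.
    by rewrite addr0 /X /psi; endo_ring.
  have t0 : tangent_space K (0 : 'End(V)).
    split; first exact: skew0.
    by rewrite comp_lfun0l comp_lfun0r addr0.
  rewrite /lie_derivative XE /anchored_bracket XL endo_diff_linear //.
  have d0 : endo_diff A K 0 = 0.
    have := endo_diff_linear (-1) (sA K) t0 t0.
    by rewrite scaler0 addr0 scaleN1r addNr.
  rewrite endo_diffZ // d0.
  have -> : conj (fun L => f L *: B L) K = f K *: conj B K.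
    by rewrite /conj; move: (B K) (F K) => *; endo_ring.
  move: (differential f K _) (f K) => df fK.
  move: (endo_diff A K _) (endo_diff B K _) => dA dB.
  move: (conj A K) (conj B K) (A K) (B K) (F K) => *.
  by endo_ring.
Qed.

End Bracket.

(** * Functions and maps preserved by the flow of a unitary C *)

Section CharacteristicInvariants.
Variables (R : realType) (V : vectType R).
Implicit Types A B C P : 'End(V).

Lemma lfun_det_conj A B P : (A \o B)%VF = \1%VF -> (B \o A)%VF = \1%VF ->
  lfun_det (A \o P \o B)%VF = lfun_det P.
Proof.
move=> AB BA; rewrite /lfun_det; set e := vbasis {:V}.
have eP : basis_of {:V} e by exact: vbasisP.
rewrite !(passmx.mxof_comp e e eP) !det_mulmx mulrCA -det_mulmx.
rewrite -(passmx.mxof_comp e e eP) AB passmx.mxof1 ?det1 ?mulr1 //.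
exact: basis_free eP.
Qed.

(** Two polynomials that agree at every real number have the same coefficients. *)
Lemma char_coefficients_inj m (c c' : 'I_m -> R) :
  (forall x : R, \sum_(j < m) (-1) ^+ j.+1 * c j * x ^+ (m - j.+1) =
     \sum_(j < m) (-1) ^+ j.+1 * c' j * x ^+ (m - j.+1)) -> c = c'.
Proof.
move=> E; apply/funext => j.
pose p (c : 'I_m -> R) : {poly R} :=
  \sum_(j < m) ((-1) ^+ j.+1 * c j) *: 'X^(m - j.+1).
have pE c0 x : (p c0).[x] = \sum_(j < m) (-1) ^+ j.+1 * c0 j * x ^+ (m - j.+1).
  by rewrite horner_sum; apply: eq_bigr => i _; rewrite hornerZ hornerXn.
have pp : p c = p c'.
  apply/eqP; rewrite -subr_eq0; apply/eqP.
  apply: (@roots_geq_poly_eq0 _ _ [seq i%:R | i <- iota 0 (size (p c - p c'))]).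
  - by apply/allP => x _; rewrite rootE hornerD hornerN !pE E subrr.
  - by rewrite map_inj_uniq ?iota_uniq // => x y /eqP; rewrite eqr_nat => /eqP.
  - by rewrite size_map size_iota.
have coef c0 : (p c0)`_(m - j.+1) = (-1) ^+ j.+1 * c0 j.
  rewrite coef_sum (bigD1 j) //= coefZ coefXn eqxx mulr1 big1 ?addr0 // => i ij.
  rewrite coefZ coefXn; case: eqP => [mij|_]; last by rewrite mulr0.
  by move: ij; rewrite -val_eqE /=; have := ltn_ord i; have := ltn_ord j; lia.
have := coef c; rewrite pp coef => /eqP.
by rewrite -subr_eq0 -mulrBr mulf_eq0 signr_eq0 /= subr_eq0 => /eqP.
Qed.

End CharacteristicInvariants.

Section FlatSections.
Variables (R : realType) (V : vectType R) (g : {dot V for idfun}).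
Variable J : twistor g.
Implicit Types (K L : twistor g) (A B T : twistor g -> 'End(V)) (C : 'End(V)).

Local Notation flat := (flat J).

Lemma flat_J : flat (const_section (J : 'End(V))).
Proof.
move=> K C sC CJ; rewrite endo_diff_cst; last exact: commutator_tangent.
by rewrite /commutator CJ subrr.
Qed.

Lemma flat_phi : flat phi.
Proof. by move=> K C sC CJ; rewrite endo_diff_phi //; exact: commutator_tangent. Qed.

Lemma flat_one : flat (const_section \1%VF).
Proof.
move=> K C sC CJ; rewrite endo_diff_cst; last exact: commutator_tangent.
by rewrite /commutator comp_lfun1l comp_lfun1r subrr.
Qed.

Lemma flatD A B : endo_smooth A -> endo_smooth B -> flat A -> flat B ->
  flat (fun L => A L + B L).
Proof.
move=> sA sB fA fB K C sC CJ; have tC := commutator_tangent K sC.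
rewrite (endo_diffD tC (sA K) (sB K)) (fA K C sC CJ) (fB K C sC CJ); endo_ring.
Qed.

Lemma flatN A : endo_smooth A -> flat A -> flat (fun L => - A L).
Proof.
move=> sA fA K C sC CJ; have tC := commutator_tangent K sC.
rewrite (endo_diffN tC (sA K)) (fA K C sC CJ); endo_ring.
Qed.

Lemma flat_comp A B : endo_smooth A -> endo_smooth B -> flat A -> flat B ->
  flat (fun L => (A L \o B L)%VF).
Proof.
move=> sA sB fA fB K C sC CJ; have tC := commutator_tangent K sC.
rewrite (endo_diff_comp tC (sA K) (sB K)) (fA K C sC CJ) (fB K C sC CJ); endo_ring.
Qed.

Lemma flatZ (h : twistor g -> R) A : smooth h -> endo_smooth A -> flat A ->
  (forall K C, orthogonal_algebra g C -> (C \o J)%VF = (J \o C)%VF ->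
     differential h K (commutator C K) = 0) ->
  flat (fun L => h L *: A L).
Proof.
move=> sh sA fA dh K C sC CJ; have tC := commutator_tangent K sC.
rewrite (endo_diffZ tC (sh K) (sA K)) (fA K C sC CJ) dh // scale0r add0r; endo_ring.
Qed.

Lemma flat_sum (I : Type) (r : seq I) (A : I -> twistor g -> 'End(V)) :
  (forall i, endo_smooth (A i)) -> (forall i, flat (A i)) ->
  flat (fun L => \sum_(i <- r) A i L).
Proof.
move=> sA fA K C sC CJ; have tC := commutator_tangent K sC.
rewrite endo_diff_sum //; last by move=> i; exact: sA.
rewrite /commutator comp_lfun_suml comp_lfun_sumr -sumrB.
by apply: eq_bigr => i _; exact: fA.
Qed.

(** The Cayley transform of t C commutes with J, so it conjugates {J, K} into
    {J, K_t}; the two have the same characteristic polynomial. *)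
Lemma char_invariant m (f : 'I_m -> twistor g -> R)
    (f_def : forall K (lambda : R),
      lfun_det (lambda *: \1%VF - anticommutator J (phi K)) =
      lambda ^+ m + \sum_(j < m) (-1) ^+ j.+1 * f j K * lambda ^+ (m - j.+1))
    K C (sC : orthogonal_algebra g C) t :
  (C \o J)%VF = (J \o C)%VF ->
  (fun j => f j (cayley_curve sC K t)) = (fun j => f j K).
Proof.
move=> CJ; apply: char_coefficients_inj => x.
apply: (addrI (x ^+ m)); rewrite -!f_def.
set A := cayley C t; set B := cayley C (- t).
have AB : (A \o B)%VF = \1%VF by exact: cayley_inv.
have BA : (B \o A)%VF = \1%VF by exact: cayley_invN.
have JA : (J \o A)%VF = (A \o J)%VF by apply: (cayley_comm sC); rewrite CJ.
have JB : (J \o B)%VF = (B \o J)%VF by apply: (cayley_comm sC); rewrite CJ.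
rewrite -(lfun_det_conj (x *: \1%VF - anticommutator J (phi K)) AB BA).
congr lfun_det; rewrite /anticommutator /phi /= -/A -/B; clearbody A B.
have E1 : (J \o (A \o K \o B) = A \o (J \o K) \o B)%VF.
  by rewrite !comp_lfunA JA.
have E2 : ((A \o K \o B) \o J = A \o (K \o J) \o B)%VF.
  by rewrite -comp_lfunA -JB !comp_lfunA.
by rewrite E1 E2 -{1}AB; endo_ring.
Qed.

End FlatSections.

(** * The sections S, Q and the theorem *)

Section AnchorData.
Variables (R : realType) (V : vectType R) (g : {dot V for idfun}).
Variable J : twistor g.
Implicit Types (K L : twistor g) (A B C : 'End(V)).

Let P K : 'End(V) := anticommutator J (phi K).

Lemma lfun_expS A i : lfun_exp A i.+1 = (A \o lfun_exp A i)%VF.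
Proof. by []. Qed.

Lemma lfun_exp_comm A B i : (A \o B)%VF = (B \o A)%VF ->
  (lfun_exp A i \o B)%VF = (B \o lfun_exp A i)%VF.
Proof.
move=> AB; elim: i => [|i IH]; first by rewrite comp_lfun1l comp_lfun1r.
by rewrite lfun_expS -comp_lfunA IH comp_lfunA AB comp_lfunA.
Qed.

Lemma lfun_exp_adjoint A i : is_adjoint g A A ->
  is_adjoint g (lfun_exp A i) (lfun_exp A i).
Proof.
move=> aA; elim: i => [|i IH]; first exact: adjoint1.
have := adjoint_comp aA IH; rewrite lfun_expS.
by rewrite [X in is_adjoint _ _ X](lfun_exp_comm i (erefl (A \o A)%VF)).
Qed.

Lemma anticommutator_adjoint K : is_adjoint g (P K) (P K).
Proof.
have aJ := twistor_adjoint J; have aK := twistor_adjoint K.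
have := adjointD (adjoint_comp aJ aK) (adjoint_comp aK aJ).
by rewrite !comp_lfunNl !comp_lfunNr !opprK [X in is_adjoint _ _ X]addrC.
Qed.

Lemma anticommutator_comm_J K : (P K \o J)%VF = (J \o P K)%VF.
Proof.
rewrite /P /anticommutator /phi ?endo_expand twistor_sqrl twistor_sqrE.
by rewrite ?endo_expand addrC.
Qed.

Lemma anticommutator_comm_phi K : (P K \o K)%VF = (K \o P K)%VF.
Proof.
rewrite /P /anticommutator /phi ?endo_expand twistor_sqrl twistor_sqrE.
by rewrite ?endo_expand addrC.
Qed.

Lemma anticommutator_comm_S S K : S_sections J S ->
  (P K \o S K)%VF = (S K \o P K)%VF.
Proof.
have PJ := anticommutator_comm_J K; have PK := anticommutator_comm_phi K.
move=> [[[|]|]|] ->; rewrite /const_section /phi.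
- by rewrite comp_lfun1l comp_lfun1r.
- by rewrite comp_lfunDl comp_lfunDr PJ PK.
- by rewrite comp_lfunDl comp_lfunDr comp_lfunNl comp_lfunNr PJ PK.
- rewrite /commutator comp_lfunDl comp_lfunDr comp_lfunNl comp_lfunNr !comp_lfunA.
  by rewrite PJ PK -!comp_lfunA PJ PK.
Qed.

Lemma S_section_smooth S : S_sections J S -> endo_smooth S.
Proof.
have sphi K := @endo_smooth_at_phi _ _ g K.
have scst C K := @endo_smooth_at_cst _ _ g C K.
move=> [[[|]|]|] -> K.
- exact: scst.
- exact: endo_smooth_atD.
- by apply: endo_smooth_atD => //; exact: endo_smooth_atN.
- exact: endo_smooth_at_commutator.
Qed.

Lemma S_section_flat S : S_sections J S -> flat J S.
Proof.
have sphi : endo_smooth (phi : twistor g -> _) by move=> K; exact: endo_smooth_at_phi.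
have sJ : endo_smooth (const_section (J : 'End(V)) : twistor g -> _).
  by move=> K; exact: endo_smooth_at_cst.
have fJ : flat J (const_section (J : 'End(V))) by exact: flat_J.
have fphi : flat J phi by exact: flat_phi.
move=> [[[|]|]|] ->.
- exact: flat_one.
- exact: (flatD sJ sphi fJ fphi).
- by apply: (flatD sJ _ fJ (flatN sphi fphi)) => K; exact: endo_smooth_atN.
- have sJphi K := endo_smooth_at_comp (sJ K) (sphi K).
  have sphiJ K := endo_smooth_at_comp (sphi K) (sJ K).
  apply: (flatD sJphi _ (flat_comp sJ sphi fJ fphi)
    (flatN sphiJ (flat_comp sphi sJ fphi fJ))) => K.
  exact: endo_smooth_atN.
Qed.

Lemma S_section_adjoint S : S_sections J S -> exists2 s : R, s * s = 1 &
  forall K, is_adjoint g (S K) (s *: S K).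
Proof.
have aJ := twistor_adjoint J.
move=> [[[|]|]|] ->.
- by exists 1 => [|K]; rewrite ?mulr1 ?scale1r //; exact: adjoint1.
- exists (-1) => [|K]; rewrite ?mulrNN ?mulr1 // scaleN1r.
  by apply/skewP; apply: skew_add; exact: twistor_skew.
- exists (-1) => [|K]; rewrite ?mulrNN ?mulr1 // scaleN1r.
  by apply/skewP; apply: skew_add; [|apply: skewN]; exact: twistor_skew.
- exists (-1) => [|K]; rewrite ?mulrNN ?mulr1 // scaleN1r.
  by apply/skewP; apply: skew_commutator; exact: twistor_skew.
Qed.

Lemma anticommutator_smooth : endo_smooth P.
Proof.
move=> K; apply: endo_smooth_atD; apply: endo_smooth_at_comp;
  by [exact: endo_smooth_at_cst|exact: endo_smooth_at_phi].
Qed.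

Lemma anticommutator_flat : flat J P.
Proof.
have sphi : endo_smooth (phi : twistor g -> _) by move=> K; exact: endo_smooth_at_phi.
have sJ : endo_smooth (const_section (J : 'End(V)) : twistor g -> _).
  by move=> K; exact: endo_smooth_at_cst.
have fJ : flat J (const_section (J : 'End(V))) by exact: flat_J.
have fphi : flat J phi by exact: flat_phi.
have sJphi K := endo_smooth_at_comp (sJ K) (sphi K).
have sphiJ K := endo_smooth_at_comp (sphi K) (sJ K).
exact: (flatD sJphi sphiJ (flat_comp sJ sphi fJ fphi) (flat_comp sphi sJ fphi fJ)).
Qed.

Lemma lfun_exp_smooth i : endo_smooth (fun K => lfun_exp (P K) i).
Proof.
elim: i => [|i IH] K; first exact: endo_smooth_at_cst.
by apply: endo_smooth_at_comp; [exact: anticommutator_smooth|exact: IH].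
Qed.

Lemma lfun_exp_flat i : flat J (fun K => lfun_exp (P K) i).
Proof.
elim: i => [|i IH]; first exact: flat_one.
apply: flat_comp => //; [exact: anticommutator_smooth|exact: lfun_exp_smooth|].
exact: anticommutator_flat.
Qed.

Section Polynomial.
Variables (k : nat) (a : 'I_k.+1 -> twistor g -> R).
Hypothesis a_smooth : forall i, smooth (a i).
Hypothesis a_invariant : forall i K C, orthogonal_algebra g C ->
  (C \o J)%VF = (J \o C)%VF -> differential (a i) K (commutator C K) = 0.

Definition anchor_poly K : 'End(V) := \sum_(i < k.+1) a i K *: lfun_exp (P K) i.

Lemma anchor_poly_smooth : endo_smooth anchor_poly.
Proof.
move=> K; apply: endo_smooth_at_sum => i; apply: endo_smooth_atZ.
  exact: a_smooth.
exact: lfun_exp_smooth.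
Qed.

Lemma anchor_poly_flat : flat J anchor_poly.
Proof.
apply: flat_sum => i.
  by move=> K; apply: endo_smooth_atZ; [exact: a_smooth|exact: lfun_exp_smooth].
by apply: flatZ; [exact: a_smooth|exact: lfun_exp_smooth|exact: lfun_exp_flat|
  move=> K C; exact: a_invariant].
Qed.

Lemma anchor_poly_comm K B : (P K \o B)%VF = (B \o P K)%VF ->
  (anchor_poly K \o B)%VF = (B \o anchor_poly K)%VF.
Proof.
move=> PB; rewrite /anchor_poly comp_lfun_suml comp_lfun_sumr.
by apply: eq_bigr => i _; rewrite -comp_lfunZl -comp_lfunZr lfun_exp_comm.
Qed.

Lemma anchor_poly_adjoint K : is_adjoint g (anchor_poly K) (anchor_poly K).
Proof.
rewrite /anchor_poly.
apply: (big_ind (fun A => is_adjoint g A A)) => [|A B|i _].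
- exact: adjoint0.
- exact: adjointD.
- by apply: adjointZ; apply: lfun_exp_adjoint; exact: anticommutator_adjoint.
Qed.

End Polynomial.
End AnchorData.

Theorem theorem4p12 (R : realType) (n : nat) (V : vectType R)
    (g : {dot V for idfun}) (n_ge2 : (4 <= 2 * n)%N)
    (dimV : \dim {:V} = (2 * n)%N) (J : twistor g)
    (f : 'I_(2 * n) -> twistor g -> R)
    (f_def : forall (K : twistor g) (lambda : R),
      lfun_det (lambda *: \1%VF - anticommutator J (phi K)) =
      lambda ^+ (2 * n) +
      \sum_(j < 2 * n) (-1) ^+ j.+1 * f j K * lambda ^+ (2 * n - j.+1))
    (k : nat) (a : 'I_k.+1 -> twistor g -> R)
    (a_smooth : forall i, smooth (a i))
    (a_poly : forall i, exists p : mpoly.mpoly (2 * n) R,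
      forall K, a i K = mpoly.meval (fun j => f j K) p)
    (S : twistor g -> 'End(V)) (S_in : S_sections J S) :
  let Q : twistor g -> 'End(V) := fun K =>
    \sum_(i < k.+1) a i K *: lfun_exp (anticommutator J (phi K)) i in
  let F : twistor g -> 'End(V) := fun K => (Q K \o S K)%VF in
  let psi : twistor g -> 'End(V) -> 'End(V) := fun K A =>
    commutator (F K \o A \o F K)%VF (phi K) in
  exists br : (twistor g -> 'End(V)) -> (twistor g -> 'End(V)) ->
      twistor g -> 'End(V),
    skew_algebroid (twisted_unitary_bundle J S) psi br.
Proof.
move=> Q F psi.
have dim2 : (2 < \dim {:V})%N by rewrite dimV; lia.
have [gamma [gammaE [e e1 [He JS SJ]]]] := S_section_intertwines S_in.
have EE := twisted_unitaryP dim2 S_in e1 He JS SJ.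
have a_inv i K C : orthogonal_algebra g C -> (C \o J)%VF = (J \o C)%VF ->
    differential (a i) K (commutator C K) = 0.
  move=> sC CJ; apply: (@differential_invariant _ _ _ (a i) K C sC (a_smooth i K)) => t.
  by have [p pE] := a_poly i; rewrite !pE (char_invariant f_def K sC t CJ).
have sQ : endo_smooth Q := anchor_poly_smooth J a_smooth.
have fQ : flat J Q by exact: anchor_poly_flat.
have sS := S_section_smooth S_in.
have Qgamma K : (Q K \o gamma K)%VF = (gamma K \o Q K)%VF.
  apply: anchor_poly_comm; case: gammaE => ->.
    exact: anticommutator_comm_J.
  exact: anticommutator_comm_phi.
have [s s1 aS] := S_section_adjoint S_in.
have sgamma : endo_smooth gamma.
  case: gammaE => -> K; first exact: endo_smooth_at_cst.
  exact: endo_smooth_at_phi.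
have fgamma : flat J gamma.
  by case: gammaE => ->; [exact: flat_J|exact: flat_phi].
exists (anchored_bracket F).
apply: (@anchored_bracket_skew_algebroid _ _ _ J _ F gamma e s) => //.
- exact: commuting_skew_subbundle gammaE EE.
- by move=> K; apply: endo_smooth_at_comp; [exact: sQ|exact: sS].
- by case: e1 => ->; rewrite ?mulrNN mulr1.
- move=> K; have := adjoint_comp (anchor_poly_adjoint J a K) (aS K).
  congr is_adjoint; rewrite -comp_lfunZl; congr (_ *: _).
  by apply/esym/anchor_poly_comm; exact: anticommutator_comm_S.
- move=> K; rewrite /F comp_lfunA.
  rewrite -[(J \o Q K)%VF](anchor_poly_comm a (anticommutator_comm_J J K)).
  by rewrite -comp_lfunA JS -comp_lfunZr comp_lfunA.
- move=> K; rewrite /F -comp_lfunA SJ -comp_lfunZr (comp_lfunA (Q K)) Qgamma.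
  by rewrite comp_lfunA.
- exact: flat_comp (S_section_flat S_in).
Qed.
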